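(* Let $F_0$ be a distribution on $\mathbb{R}_+$ with density $f_0$ and mean $1$ and hazard rate $\eta(t)=f_0(t)/(1-F_0(t))$. For each $N$, consider a local memory system with $N$ items, memory size $C_N$ (an integer, $1\le C_N<N$), and independent stationary renewal request processes $\Phi_1,\dots,\Phi_N$ with intensities $\lambda_1^{(N)}\ge\dots\ge\lambda_N^{(N)}>0$, where $\Phi_i$ has inter-arrival distribution $F_0(\lambda_i^{(N)}t)$. Assume: (i) $L_N(\lambda):=\frac1N\sum_{i=1}^N\mathbf{1}_{\{\lambda_i^{(N)}\le\lambda\}}$ converges weakly to a probability distribution $L$ with no atom at $0$; (ii) for each $N\ge1$ and $1\le i\ne j\le N$, $P^0_\Phi(X_i^{(N)}=X_j^{(N)})=0$, where $X_i^{(N)}$ are the observed hazard rates at time $0$ and $\Phi=\sum_{i=1}^N\Phi_i$. Suppose that $\int_0^\infty\lambda\,L(d\lambda)=\infty$ and that $C_N/N\to c\in(0,1]$ as $N\to\infty$. Let $\mathcal{C}^*$ be the optimal causal policy and $\mathcal{C}^s\equiv\{1,\dots,C_N\}$ the static policy. Then their miss probabilities satisfy $$M^{(N)}_{\mathcal{C}^*}\le M^{(N)}_{\mathcal{C}^s}\longrightarrow0\quad\text{as }N\to\infty.$$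
   Context: Framework: $(\Omega,\mathcal{F},P)$ carries a measurable flow $\{\vartheta_t\}$ preserving $P$, and stationarity means compatibility with the flow. The Palm probability of a stationary point process $\Phi$ of intensity $\lambda=\mathrm{E}[\Phi((0,1])]$ is $P^0_\Phi(A)=\frac1\lambda\mathrm{E}[\int_{(0,1]}\mathbf{1}_A(\vartheta_s\omega)\Phi(ds)]$. A stationary renewal process is a stationary simple point process whose inter-arrival times are i.i.d. under its Palm probability. $\eta_i(t)=\lambda_i^{(N)}\eta(\lambda_i^{(N)}t)$ is the hazard rate of the $i$-th process, $\tau_i^-(t)$ is the last point of $\Phi_i$ strictly before $t$, the stochastic intensity of $\Phi_i$ with respect to its natural history is $\lambda_i(t)=\eta_i(t-\tau_i^-(t))$, and $X_i^{(N)}=\lambda_i(0)$ is the observed hazard rate. A storage policy $\mathcal{C}(t)$ specifies the subset of at most $C_N$ items of $\{1,\dots,N\}$ stored at time $t$. The optimal causal policy $\mathcal{C}^*$ stores at every time $t$ the $C_N$ items with the largest values of $\lambda_i(t)$ (ties broken by an arbitrary deterministic rule). With $\lambda^N=\sum_{i=1}^N\lambda_i^{(N)}$, the miss probability of a policy $\mathcal{C}$ is $M^{(N)}_{\mathcal{C}}=\sum_{i=1}^N\frac{\lambda_i^{(N)}}{\lambda^N}P^0_{\Phi_i}(i\notin\mathcal{C}(0))$, which equals $1-P^0_\Phi(\Psi_{\mathcal{C}}(\{0\})=1)$ where $\Psi_{\mathcal{C}}(B)=\sum_{i=1}^N\int_B\mathbf{1}_{\{i\in\mathcal{C}(t)\}}\Phi_i(dt)$.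 *)

(* Defs.v *)
From HB Require Import structures.
From mathcomp Require Import all_boot all_order all_algebra.
From mathcomp Require Import all_classical all_reals all_analysis.
From mathcomp Require Import measurable_realfun.

Set Implicit Arguments.
Unset Strict Implicit.
Unset Printing Implicit Defensive.

Import Order.TTheory GRing.Theory Num.Theory.
Import numFieldNormedType.Exports.

Local Open Scope classical_set_scope.
Local Open Scope ring_scope.

Record measure_preserving_flow (R : realType) (d : measure_display)
    (T : measurableType d) (P : probability T R) (theta : R -> T -> T) : Prop := {
  flow0 : forall w, theta 0 w = w;
  flowD : forall s t w, theta (s + t) w = theta s (theta t w);
  flow_measurable :
    measurable_fun setT (fun p : measurableTypeR R * T => theta p.1 p.2);
  flow_preserving :
    forall t A, measurable A -> P (theta t @^-1` A) = P A
}.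

(* A counting measure is treated as the measure of its points: [s] is a point
   of [mu] when [mu [set s]] is non-zero. *)
Section points_of_a_counting_measure.
Variables (R : realType) (mu : set R -> \bar R).

Definition point_of (s : R) : Prop := mu [set s] != 0%E.

(* [sup] and [inf] take the value 0 on the empty set; for a stationary process
   with a.s. some point, this occurs with probability 0 only. *)
Definition last_before (t : R) : R := sup [set s | s < t /\ point_of s].

Definition first_after (t : R) : R := inf [set s | t < s /\ point_of s].

(* The points are numbered so that ... < T_(-1) < T_0 <= 0 < T_1 < ... *)
Definition nth_point (k : int) : R :=
  let T0 := sup [set s | s <= 0 /\ point_of s] in
  match k with
  | Posz n => iter n first_after T0
  | Negz n => iter n.+1 last_before T0
  end.

Definition interarrival (k : int) : R := nth_point (k + 1) - nth_point k.

End points_of_a_counting_measure.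

Section point_processes.
Variables (R : realType) (d : measure_display) (T : measurableType d).
Variables (P : probability T R) (theta : R -> T -> T).
Implicit Types Phi : R.-ker T ~> measurableTypeR R.

Definition point_process Phi : Prop :=
  forall w (B : set (measurableTypeR R)), measurable B -> bounded_set (B : set R) ->
    exists n : nat, Phi w B = (n%:R)%:E.

Definition simple_process Phi : Prop :=
  {ae P, forall w, forall x : R, (Phi w [set x] <= 1)%E}.

Definition flow_compatible Phi : Prop :=
  forall t w (B : set (measurableTypeR R)), measurable B ->
    Phi (theta t w) B = Phi w [set x : R | B (x - t)].

Definition intensity Phi : \bar R := (\int[P]_w Phi w `]0%R, 1%R]%classic)%E.

Definition palm Phi (A : set T) : \bar R :=
  ((fine (intensity Phi))^-1%:E *
   \int[P]_w \int[Phi w]_(s in `]0%R, 1%R]) (\1_A (theta s w))%:E)%E.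

Definition iid_under (Q : set T -> \bar R) (S : int -> T -> R) : Prop :=
  (forall (ks : seq int) (B : int -> set (measurableTypeR R)), uniq ks ->
     (forall k, measurable (B k)) ->
     Q [set w | forall k, k \in ks -> B k (S k w)] =
     (\prod_(k <- ks) Q [set w | B k (S k w)])%E) /\
  (forall k l (B : set (measurableTypeR R)), measurable B ->
     Q [set w | B (S k w)] = Q [set w | B (S l w)]).

Definition stationary_renewal_process Phi : Prop :=
  [/\ point_process Phi, simple_process Phi, flow_compatible Phi &
      iid_under (palm Phi) (fun k w => interarrival (Phi w) k)].

Definition interarrival_distribution Phi (G : R -> R) : Prop :=
  forall k t, palm Phi [set w | interarrival (Phi w) k <= t] = (G t)%:E.

Definition sigma_of Phi : set (set T) :=
  <<s [set A | exists (B : set (measurableTypeR R)) (V : set (\bar R)),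
         [/\ measurable B, measurable V & A = [set w | V (Phi w B)]]] >>.

Definition independent_processes (N : nat)
    (Phi : 'I_N -> R.-ker T ~> measurableTypeR R) : Prop :=
  forall (J : {set 'I_N}) (A : 'I_N -> set T),
    (forall i, i \in J -> sigma_of (Phi i) (A i)) ->
    P [set w | forall i, i \in J -> A i w] = (\prod_(i in J) P (A i))%E.

End point_processes.

Section superposition.
Variables (R : realType) (d : measure_display) (T : measurableType d).
Variables (N : nat) (Phi : 'I_N -> R.-ker T ~> measurableTypeR R).

Definition superposition (w : T) (B : set (measurableTypeR R)) : \bar R :=
  (\sum_(i < N) Phi i w B)%E.

Section measure.
Variable w : T.

Let superposition0 : superposition w set0 = 0%E.
Proof. by rewrite /superposition big1. Qed.

Let superposition_ge0 B : (0 <= superposition w B)%E.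
Proof. by rewrite /superposition; apply: sume_ge0. Qed.

Let superposition_sigma_additive : semi_sigma_additive (superposition w).
Proof.
move=> F mF tF mUF; rewrite [X in _ --> X](_ : _ =
    limn (fun n => (\sum_(0 <= i < n) superposition w (F i))%E)).
  by apply: is_cvg_ereal_nneg_natsum => k _; exact: superposition_ge0.
rewrite nneseries_sum//; apply: eq_bigr => /= i _.
exact: measure_semi_bigcup.
Qed.

HB.instance Definition _ := isMeasure.Build _ _ _ (superposition w)
  superposition0 superposition_ge0 superposition_sigma_additive.

End measure.

Definition ksuperposition (w : T) : {measure set (measurableTypeR R) -> \bar R} :=
  superposition w.

Let measurable_ksuperposition U :
  measurable U -> measurable_fun [set: T] (ksuperposition ^~ U).
Proof. by move=> mU; apply: emeasurable_sum => i; exact/measurable_kernel. Qed.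

HB.instance Definition _ :=
  isKernel.Build _ _ _ _ _ ksuperposition measurable_ksuperposition.

End superposition.

Section distributions.
Variable R : realType.
Implicit Types Q : probability (measurableTypeR R) R.

Definition distribution_function Q (t : R) : R := fine (Q `]-oo, t]%classic).

Definition density Q (f : R -> R) : Prop :=
  [/\ measurable_fun setT f, forall t, 0 <= f t &
      forall A : set (measurableTypeR R), measurable A ->
        Q A = (\int[lebesgue_measure]_(t in A) (f t)%:E)%E].

(* Weak convergence of distribution functions: pointwise convergence at the
   continuity points of the limit. *)
Definition weakly_converges (G : nat -> R -> R) Q : Prop :=
  forall x, {for x, continuous (distribution_function Q)} ->
    G n x @[n --> \oo] --> distribution_function Q x.

Definition hazard_rate Q (f : R -> R) (t : R) : R :=
  f t / (1 - distribution_function Q t).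

Definition scaled_hazard_rate Q (f : R -> R) (lambda t : R) : R :=
  lambda * hazard_rate Q f (lambda * t).

Definition empirical_distribution (N : nat) (lambda : 'I_N -> R) (x : R) : R :=
  N%:R^-1 * \sum_(i < N) (lambda i <= x)%R%:R.

End distributions.

Section memory_system.
Variables (R : realType) (d : measure_display) (T : measurableType d).
Variables (P : probability T R) (theta : R -> T -> T).
Variables (F0 : probability (measurableTypeR R) R) (f0 : R -> R).
Variables (N : nat) (lambda : 'I_N -> R).
Variable Phi : 'I_N -> R.-ker T ~> measurableTypeR R.

Definition stochastic_intensity (i : 'I_N) (w : T) (t : R) : R :=
  scaled_hazard_rate F0 f0 (lambda i) (t - last_before (Phi i w) t).

Definition observed_hazard (i : 'I_N) (w : T) : R := stochastic_intensity i w 0.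

Definition storage_policy (C : nat) (S : T -> R -> {set 'I_N}) : Prop :=
  (forall w t, (#|S w t| <= C)%N) /\
  (forall i t, measurable [set w | i \in S w t]).

(* [rule] is the deterministic way of selecting [C] largest values, hence of
   breaking ties. *)
Definition optimal_causal_policy (C : nat) (S : T -> R -> {set 'I_N}) : Prop :=
  storage_policy C S /\
  exists rule : ('I_N -> R) -> {set 'I_N},
    (forall x, #|rule x| = C /\
       forall i j, i \in rule x -> j \notin rule x -> x j <= x i) /\
    (forall w t, S w t = rule (fun i => stochastic_intensity i w t)).

Definition static_policy (C : nat) (w : T) (t : R) : {set 'I_N} :=
  [set i : 'I_N | (i < C)%N]%SET.

Definition miss_probability (S : T -> R -> {set 'I_N}) : \bar R :=
  (\sum_(i < N) (lambda i / \sum_(j < N) lambda j)%:E *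
     palm P theta (Phi i) [set w | i \notin S w 0%R])%E.

End memory_system.

(* Main.v *)
Require Import Defs.
From mathcomp Require Import all_boot all_order all_algebra.
From mathcomp Require Import all_classical all_reals all_analysis.
From mathcomp Require Import measurable_realfun lra.
From HB Require Import structures.
Import Order.TTheory GRing.Theory Num.Theory.
Import numFieldNormedType.Exports.

(** The stochastic intensity identity drives the proof: for Q depending only on
    the comparison of X_i with the observed hazard rates X_j, j <> i,
    lambda_i P^0_i(Q) = E[X_i 1_Q].  Under P^0_i the age A_i of item i, scaled by
    lambda_i, has law F_0(dy) = (1 - F_0(y)) eta(y) dy, while under P it has law
    (1 - F_0(y)) dy by the Campbell-Mecke formula and the renewal property, so the
    factor lambda_i eta(lambda_i A_i) = X_i passes between the two; independence
    takes care of the other items.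

    Up to ties, i is missed by the optimal policy iff at least C_N other items
    have a larger X_j.  Hence lambda^N M_opt is the expectation of the sum of X_i
    over items missed, which is at most the sum of X_i over i > C_N, because the
    optimal policy keeps the C_N largest ones; and E X_i = lambda_i turns this bound into
    lambda^N M_static.

    M_static is the sum of lambda_i over i > C_N divided by the sum of all of
    them.  As C_N / N tends to c > 0, the rates in the numerator are eventually
    bounded by a constant K with 1 - L(K) < c / 2, whereas the empirical means of
    the rates tend to infinity because L has infinite mean. *)

Set Implicit Arguments.
Unset Strict Implicit.
Unset Printing Implicit Defensive.

Local Open Scope classical_set_scope.
Local Open Scope ring_scope.
Local Open Scope ereal_scope.

(** * Measure-theoretic complements *)

(** The main obstacle is measurability. [palm] is an iterated integral that makes sense on every
    set, and interarrival times are built from suprema with default values, so Palm events are not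
    known to be measurable. The proof therefore works with a genuine measure [M], the intensity
    times the Palm probability, and replaces each event by a measurable one that agrees with it on
    configurations having a point at 0. On those, interarrival time -1 is the age and interarrival
    time 0 is the wait for the next point. A second difficulty is that the flow moves all processes
    at once, so that the Palm measure of one item also shifts the others. Independence lets the
    others be read off a separate outcome, where the invariance of [P] removes the shift. Ties are
    handled by two one-sided inclusions. A miss implies [C] strict dominators off the ties, which
    are negligible under the Palm measure; [C] strict dominators imply a miss at every outcome,
    which is the inclusion used under [P]. *)

Section mixture.
Context d d' (X : measurableType d) (Z : measurableType d') (R : realType).
Variables (P : {measure set X -> \bar R}) (K : X -> {measure set Z -> \bar R}).
Variable M : {measure set Z -> \bar R}.
Hypothesis mK : forall U, measurable U -> measurable_fun setT (fun x => K x U).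
Hypothesis ME : forall U, measurable U -> M U = \int[P]_x K x U.

Import HBNNSimple.

Let integral_mixture_nnsfun (h : {nnsfun Z >-> R}) :
  \int[M]_z (h z)%:E = \int[P]_x \int[K x]_z (h z)%:E.
Proof.
rewrite integralT_nnsfun sintegralE.
under [RHS]eq_integral do rewrite integralT_nnsfun sintegralE.
rewrite ge0_integral_fsum//; last 2 first.
- by move=> r; apply: measurable_funeM; exact: mK.
- move=> r x _; have [r0|r0] := leP 0%R r; first by rewrite mule_ge0.
  by rewrite preimage_nnfun0// measure0 mule0.
apply: eq_fsbigr => r _; have [r0|r0] := leP 0%R r.
  by rewrite ME// ge0_integralZl//; exact: mK.
rewrite preimage_nnfun0// measure0 mule0 integral0_eq// => x _.
by rewrite measure0 mule0.
Qed.

(** Both sides agree on simple functions by additivity; monotone convergence, used under [M], under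
    each [K x] and then under [P], carries the equality to [f]. *)
Lemma integral_mixture (f : Z -> \bar R) : (forall z, 0 <= f z) ->
  measurable_fun setT f -> \int[M]_z f z = \int[P]_x \int[K x]_z f z.
Proof.
move=> f0 mf; pose f_ := nnsfun_approx measurableT mf.
have mf_ n : measurable_fun setT (fun z => (f_ n z)%:E).
  exact/measurable_EFinP.
have ndf z : {homo (fun n => (f_ n z)%:E) : n m / (n <= m)%N >-> n <= m}.
  by move=> a b ab; rewrite lee_fin; exact/lefP/nd_nnsfun_approx.
have intf (N : {measure set Z -> \bar R}) :
    \int[N]_z f z = limn (fun n => \int[N]_z (f_ n z)%:E).
  rewrite -monotone_convergence//; last by move=> n z _; rewrite lee_fin.
  by apply: eq_integral => z _; apply/esym/cvg_lim => //; exact: cvg_nnsfun_approx.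
rewrite intf; under [RHS]eq_integral do rewrite intf.
rewrite monotone_convergence//.
- by congr (limn _); apply/funext => n; rewrite integral_mixture_nnsfun.
- move=> n; apply: measurable_fun_integral_kernel => // z.
  by rewrite lee_fin.
- by move=> n x _; apply: integral_ge0 => z _; rewrite lee_fin.
- move=> x _ a b ab; apply: ge0_le_integral => //.
  + by move=> z _; rewrite lee_fin.
  + by move=> z _; exact: ndf.
Qed.

End mixture.

Section density.
Context d (X : measurableType d) (R : realType).
Variables (mu nu : {measure set X -> \bar R}) (h : X -> R).
Hypothesis h0 : forall x, (0 <= h x)%R.
Hypothesis mh : measurable_fun setT h.
Hypothesis nuE : forall U, measurable U ->
  nu U = \int[mu]_x ((h x)%:E * (\1_U x)%:E).

(** A measure with density [h] is the mixture over [mu] of the point masses at [x] with weight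
    [h x]. *)
Lemma ge0_integral_density (f : X -> \bar R) : (forall x, 0 <= f x) ->
  measurable_fun setT f -> \int[nu]_x f x = \int[mu]_x ((h x)%:E * f x).
Proof.
move=> f0 mf; pose K x : {measure set X -> \bar R} := mscale (NngNum (h0 x)) (\d_x).
rewrite (@integral_mixture _ _ _ _ _ mu K)//.
- by apply: eq_integral => x _; rewrite ge0_integral_mscale//= integral_dirac// diracT mul1e.
- move=> U mU; rewrite /K/= /mscale/=; apply: emeasurable_funM.
    exact/measurable_EFinP.
  by apply/measurable_EFinP; exact: measurable_indic.
Qed.

End density.

Lemma ge0_integral_mrestr d (X : measurableType d) (R : realType)
    (mu : {measure set X -> \bar R}) (D : set X) (mD : measurable D) (f : X -> \bar R) :
  (forall x, 0 <= f x) -> measurable_fun setT f ->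
  \int[mrestr mu mD]_x f x = \int[mu]_(x in D) f x.
Proof.
move=> f0 mf; rewrite (@ge0_integral_density _ _ _ mu (mrestr mu mD) \1_D)//.
  rewrite [RHS]integral_mkcond; apply: eq_integral => x _; rewrite patchE indicE.
  by case: ifPn => _; rewrite ?mul1e ?mul0e.
move=> U mU; have mUD : measurable (U `&` D) by exact: measurableI.
rewrite -[LHS]/(mu (U `&` D)).
have := integral_indic mu measurableT mUD; rewrite setIT => <-.
by apply: eq_integral => x _; rewrite -EFinM indicI mulrC.
Qed.

Section measure_of_mixture.
Context d d' (X : measurableType d) (Z : measurableType d') (R : realType).
Variables (P : {measure set X -> \bar R}) (K : X -> {measure set Z -> \bar R}).

Definition mixture U := \int[P]_x K x U.

Hypothesis mK : forall U, measurable U -> measurable_fun setT (fun x => K x U).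

Let mixture0 : mixture set0 = 0.
Proof. by rewrite /mixture integral0_eq// => x _; rewrite measure0. Qed.

Let mixture_ge0 U : 0 <= mixture U.
Proof. exact: integral_ge0. Qed.

Let mixture_sigma_additive : semi_sigma_additive mixture.
Proof.
move=> F mF tF mUF; rewrite [X in _ --> X](_ : _ =
    \sum_(n <oo) \int[P]_x K x (F n)); last first.
  rewrite -integral_nneseries//; last by move=> n; exact: mK.
  apply: eq_integral => x _.
  by apply/esym/cvg_lim => //; exact: measure_semi_sigma_additive.
by apply: is_cvg_nneseries => n _ _; exact: integral_ge0.
Qed.

Definition mixture_measure : {measure set Z -> \bar R} :=
  HB.pack mixture (isMeasure.Build _ _ _ mixture
    mixture0 mixture_ge0 mixture_sigma_additive).

End measure_of_mixture.

Section sigma_finite_measure_of.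
Context d (T : measurableType d) (R : realType) (mu : {measure set T -> \bar R}).
Hypothesis sf : sigma_finite setT mu.

(* The body mentions [sf] so that the measure instance below can recover it. *)
Definition sigma_finite_measure_of : set T -> \bar R := let _ := sf in mu.

HB.instance Definition _ := Measure.on sigma_finite_measure_of.
HB.instance Definition _ :=
  Measure_isSigmaFinite.Build _ _ _ sigma_finite_measure_of sf.

End sigma_finite_measure_of.

Section integral_off_null.
Context d (T : measurableType d) (R : realType).
Variables (mu : {measure set T -> \bar R}).

Import HBNNSimple.

(** Neither [f], [g] nor [D] is assumed measurable, which is what allows indicators of arbitrary
    Palm events. The integral being a supremum over simple functions, it suffices that a simple
    function below [f], once set to 0 on [N], keeps its integral and lies below [g]. *)
Let integral_off_null_le (D N : set T) (f g : T -> \bar R) :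
  measurable N -> mu N = 0 -> (forall x, 0 <= f x) -> (forall x, 0 <= g x) ->
  (forall x, D x -> ~ N x -> f x = g x) ->
  \int[mu]_(x in D) f x <= \int[mu]_(x in D) g x.
Proof.
move=> mN N0 f0 g0 fg; rewrite !ge0_integralE//=.
apply: ge_ereal_sup => _ [h hf <-].
pose h' : {nnsfun T >-> R} := proj_nnsfun h (measurableC mN).
have -> : sintegral mu h = sintegral mu h'.
  rewrite -!integralT_nnsfun; apply: ge0_ae_eq_integral => //.
  - exact/measurable_EFinP.
  - exact/measurable_EFinP.
  - by move=> x _; rewrite lee_fin.
  - by move=> x _; rewrite lee_fin.
  - exists N; split => // x /= hx; apply: contrapT => Nx; apply: hx => _.
    by rewrite /= /mindic indicE mem_set// mulr1.
apply: ereal_sup_ubound; exists h' => // x.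
rewrite /= /mindic indicE.
have [Nx|Nx] := pselect (N x).
  by rewrite memNset ?mulr0; [exact: erestrict_ge0|exact].
rewrite mem_set// mulr1; apply: le_trans (hf x) _; rewrite !patchE.
by case: ifPn => // /set_mem Dx; rewrite fg.
Qed.

Lemma integral_off_null (D N : set T) (f g : T -> \bar R) :
  measurable N -> mu N = 0 -> (forall x, 0 <= f x) -> (forall x, 0 <= g x) ->
  (forall x, D x -> ~ N x -> f x = g x) ->
  \int[mu]_(x in D) f x = \int[mu]_(x in D) g x.
Proof.
move=> mN N0 f0 g0 fg; apply/eqP; rewrite eq_le.
rewrite !(@integral_off_null_le _ N)// => x Dx Nx; exact/esym/fg.
Qed.

End integral_off_null.

(** * Affine change of variable for Lebesgue measure *)

Section lebesgue_affine.
Context (R : realType).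
Local Notation leb := (@lebesgue_measure R).

Lemma measurable_affine (a b : R) :
  measurable_fun setT ((fun x => a * x + b)%R : R -> R).
Proof.
apply: measurable_funD; last exact: measurable_cst.
exact: mulrl_measurable.
Qed.

(** The image of Lebesgue measure under the affine map, scaled by [|a|], gives []x, y]] its length,
    so it is Lebesgue measure by uniqueness. For [a < 0] the preimage is closed on the left instead,
    with the same length. *)
Lemma ge0_integral_affine (a b : R) (f : R -> \bar R) : (a != 0)%R ->
  (forall x, 0 <= f x) -> measurable_fun setT (f : measurableTypeR R -> \bar R) ->
  \int[leb]_x f x = `|a|%:E * \int[leb]_x f (a * x + b)%R.
Proof.
move=> a0 f0 mf; have na0 : (0 <= `|a|)%R by [].
pose phi (x : measurableTypeR R) : measurableTypeR R := (a * x + b)%R.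
have mphi : measurable_fun setT phi := measurable_affine a b.
pose m := mscale (NngNum na0) (pushforward leb phi).
rewrite (@eq_measure_integral _ _ _ setT (m mphi)); last first.
  move=> A mA _; apply: (lebesgue_measure_unique _ mA) => _ [[x y] xy <-].
  rewrite /m/= /mscale/= /pushforward/=.
  have -> : phi @^-1` `]x, y]%classic =
     [set` if (0 < a)%R then `](x - b) / a, (y - b) / a]%R else `[(y - b) / a, (x - b) / a[%R].
    apply/seteqP; split => t; rewrite /phi/=.
      case: (ltgtP 0%R a) a0 => // [a0 _|a0 _].
      - by rewrite !in_itv/= ltr_pdivrMr// ler_pdivlMr// ltrBlDr lerBrDr mulrC.
      - by rewrite !in_itv/= ltr_ndivlMr// ler_ndivrMr// ltrBlDr lerBrDr andbC mulrC.
    case: (ltgtP 0%R a) a0 => // [a0 _|a0 _].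
    - by rewrite !in_itv/= ltr_pdivrMr// ler_pdivlMr// ltrBlDr lerBrDr mulrC.
    - by rewrite !in_itv/= ltr_ndivlMr// ler_ndivrMr// ltrBlDr lerBrDr andbC mulrC.
  rewrite !lebesgue_measure_itv/= lte_fin.
  case: (ltgtP 0%R a) a0 => // [a0 _|a0 _]; rewrite /= lte_fin.
  - rewrite ltr_pM2r ?invr_gt0// ltrD2r; case: ifP; rewrite ?mule0// => _.
    rewrite gtr0_norm// -!EFinB -EFinM -mulrBl mulrCA divff ?gt_eqF// mulr1.
    by rewrite opprB addrA subrK.
  - rewrite ltr_nM2r ?invr_lt0// ltrD2r; case: ifP; rewrite ?mule0// => _.
    rewrite ltr0_norm// -!EFinB -EFinM -mulrBl mulrCA mulNr divff ?lt_eqF//.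
    by rewrite mulrN1 opprB [in RHS]opprB addrA subrK.
rewrite ge0_integral_mscale//=; congr (_ * _).
rewrite ge0_integral_pushforward//; exact: measurable_affine.
Qed.

End lebesgue_affine.

(** * Kernels that are finite along an exhausting sequence of sets *)

Section locally_finite_kernel.
Context d d' (X : measurableType d) (Y : measurableType d') (R : realType).
Variable K : X -> {measure set Y -> \bar R}.
Hypothesis mK : forall U, measurable U -> measurable_fun setT (fun x => K x U).
Variable D : (set Y)^nat.
Hypothesis mD : forall n, measurable (D n).
Hypothesis ndD : nondecreasing_seq D.
Hypothesis UD : \bigcup_n D n = setT.
Hypothesis Dfin : forall n x, K x (D n) < +oo.

(** A counting measure may have infinite total mass but is finite on bounded sets. Restricting it to
    [D n] reduces the claim to finite measures, and continuity from below recovers the whole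
    section. *)
Lemma measurable_fun_xsection_kernel (A : set (X * Y)) : measurable A ->
  measurable_fun setT (fun x => K x (xsection A x)).
Proof.
move=> mA; pose phi n x := mrestr (K x) (mD n) (xsection A x).
pose k : R.-ker X ~> Y := HB.pack K (isKernel.Build _ _ _ _ _ K mK).
have mphi n : measurable_fun setT (phi n).
  have [|_ +] := @measurable_prod_subset_xsection_kernel _ _ _ _ _ k _ (mD n) _ _ mA.
    move=> x; exists (fine (K x (D n)) + 1)%R => U mU; rewrite /mrestr/=.
    rewrite EFinD fineK ?ge0_fin_numE//.
    apply: (@le_lt_trans _ _ (K x (D n))).
      by rewrite le_measure ?inE//; exact: measurableI.
    by rewrite lteDl ?lte_fin// ge0_fin_numE.
  exact.
apply: (emeasurable_fun_cvg _ _ mphi) => x _.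
rewrite -[X in _ --> K x X](_ : \bigcup_n (xsection A x `&` D n) = _); last first.
  by rewrite -setI_bigcupr UD setIT.
apply: nondecreasing_cvg_mu.
- by move=> n; apply: measurableI => //; exact: measurable_xsection.
- by apply: bigcup_measurable => n _; apply: measurableI => //; exact: measurable_xsection.
- by move=> m n mn; apply/subsetPset; apply: setIS; exact/subsetPset/ndD.
Qed.

Import HBNNSimple.

Lemma measurable_fun_integral_locally_finite_kernel (f : X * Y -> \bar R) :
  (forall z, 0 <= f z) -> measurable_fun setT f ->
  measurable_fun setT (fun x => \int[K x]_y f (x, y)).
Proof.
move=> f0 mf; pose f_ := nnsfun_approx measurableT mf.
apply: (measurable_fun_xsection_integral f K f_).
- by move=> a b ab; exact/nd_nnsfun_approx.
- by move=> z; exact/cvg_nnsfun_approx.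
- by move=> n r; exact: measurable_fun_xsection_kernel.
Qed.

End locally_finite_kernel.

Section kernel_fubini.
Context d d' d'' (X : measurableType d) (Y : measurableType d') (Z : measurableType d'').
Context (R : realType).
Variable K : X -> {measure set Y -> \bar R}.
Hypothesis mK : forall U, measurable U -> measurable_fun setT (fun x => K x U).
Variable D : (set Y)^nat.
Hypothesis mD : forall n, measurable (D n).
Hypothesis ndD : nondecreasing_seq D.
Hypothesis UD : \bigcup_n D n = setT.
Hypothesis Dfin : forall n x, K x (D n) < +oo.
Variables (m : {sigma_finite_measure set Z -> \bar R}).
Variables (P : {sigma_finite_measure set X -> \bar R}).

(** Tonelli is applied twice: to [m] and [P], then for fixed [x] to [m] and [K x], which is
    sigma-finite thanks to the sets [D n]. *)
Lemma fubini_tonelli_kernel (h : (Z * X) * Y -> \bar R) :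
  (forall z, 0 <= h z) -> measurable_fun setT h ->
  \int[m]_z \int[P]_x \int[K x]_y h (z, x, y) =
  \int[P]_x \int[K x]_y \int[m]_z h (z, x, y).
Proof.
move=> h0 mh.
have mKh : measurable_fun setT (fun zx : Z * X => \int[K zx.2]_y h (zx, y)).
  apply: (@measurable_fun_integral_locally_finite_kernel _ _ _ _ _ (fun zx => K zx.2) _ D) => //.
  by move=> U mU; apply: (measurableT_comp (mK mU)).
rewrite (@fubini_tonelli _ _ _ _ _ _ _ (fun zx : Z * X => \int[K zx.2]_y h (zx, y)))//=; last first.
  by move=> zx; exact: integral_ge0.
apply: eq_integral => x _.
have sfK : sigma_finite setT (K x) by exists D => // n; split.
rewrite -[LHS]/(\int[m]_z \int[sigma_finite_measure_of sfK]_y h (z, x, y)).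
rewrite (@fubini_tonelli _ _ _ _ _ _ _ (fun zy : Z * Y => h (zy.1, x, zy.2)))//=.
by apply: (measurableT_comp mh); do 2! apply: measurable_fun_pair => //.
Qed.

End kernel_fubini.

(** * Points of integer-valued measures *)

Definition integer_valued (R : realType) (mu : set (measurableTypeR R) -> \bar R) :=
  forall B, measurable B -> bounded_set (B : set R) ->
    exists n : nat, mu B = (n%:R)%:E.

Section null_sets.
Context d (T : measurableType d) (R : realType) (mu : {measure set T -> \bar R}).

Lemma measure_bigcup_eq0 (F : (set T)^nat) : (forall n, measurable (F n)) ->
  (forall n, mu (F n) = 0) -> mu (\bigcup_n F n) = 0.
Proof.
move=> mF F0; apply/eqP; rewrite -measure_le0.
have := measure_sigma_subadditive mu mF (bigcupT_measurable _ mF) (@subset_refl _ _).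
by move/le_trans; apply; rewrite eseries0// => n _ _; rewrite F0.
Qed.

Lemma subset_measure_eq0 (A B : set T) : measurable A -> measurable B ->
  A `<=` B -> mu B = 0 -> mu A = 0.
Proof.
by move=> mA mB AB B0; apply/eqP; rewrite -measure_le0 -B0 le_measure ?inE.
Qed.

End null_sets.

Section integer_valued_measure.
Context (R : realType) (mu : {measure set (measurableTypeR R) -> \bar R}).
Hypothesis mu_int : integer_valued mu.

Lemma integer_valued_ge1 (B : set (measurableTypeR R)) : measurable B ->
  bounded_set (B : set R) -> mu B != 0 -> 1 <= mu B.
Proof.
move=> mB bB; have [n ->] := mu_int mB bB.
by rewrite eqe pnatr_eq0 -lt0n lee_fin ler1n.
Qed.

(** A charged bounded set has mass at least 1, and this bound survives the limit along a decreasing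
    sequence. *)
Lemma integer_valued_bigcap (J : (set (measurableTypeR R))^nat) :
  (forall n, measurable (J n)) -> (forall n, bounded_set (J n : set R)) ->
  nonincreasing_seq J -> (forall n, mu (J n) != 0) -> mu (\bigcap_n J n) != 0.
Proof.
move=> mJ bJ niJ J0; have cJ : mu (J n) @[n --> \oo] --> mu (\bigcap_n J n).
  apply: nonincreasing_cvg_mu => //; last exact: bigcapT_measurable.
  by have [m ->] := mu_int (mJ 0%N) (bJ 0%N); exact: ltry.
suff : 1 <= mu (\bigcap_n J n) by apply: contraTneq => ->; rewrite lee_fin ler10.
rewrite -(cvg_lim _ cJ)//; apply: lime_ge; first exact: cvgP cJ.
by apply: nearW => n; exact: integer_valued_ge1.
Qed.

Lemma bounded_set_itvcc (a b : R) : bounded_set `[a, b]%classic.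
Proof. exact/compact_bounded/segment_compact. Qed.

Lemma bounded_subset (A B : set R) : A `<=` B -> bounded_set B -> bounded_set A.
Proof.
by move=> AB [M [Mr MB]]; exists M; split => // x /MB Bx y /AB; exact: Bx.
Qed.

Lemma bounded_set_itv (b0 b1 : bool) (a b : R) :
  bounded_set [set` Interval (BSide b0 a) (BSide b1 b)].
Proof.
apply: bounded_subset (bounded_set_itvcc a b).
by apply: subset_itv; rewrite bnd_simp; [case: b0|case: b1]; rewrite /= bnd_simp.
Qed.

(** The atom is the supremum [y] of the levels below which [B] has no mass. The sets [J n], which
    extend past [y], are charged and so is their intersection; the part of it strictly below [y] is
    null, which leaves [y] itself. *)
Lemma integer_valued_atom (B : set (measurableTypeR R)) : measurable B ->
  bounded_set (B : set R) -> mu B != 0 -> exists2 s, B s & mu [set s] != 0.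
Proof.
move=> mB bB muB; have : exists M : R, B `<=` `[(- M)%R, M].
  have [M [_ MB]] := bB; exists (M + 1)%R => x /(MB (M + 1)%R).
  by rewrite ltrDl ltr01 /= in_itv/= -ler_norml; exact.
move=> [M BM].
pose I (y : R) : set (measurableTypeR R) := B `&` `]-oo, y]%classic.
have mI y : measurable (I y) by exact: measurableI.
have bI y : bounded_set (I y : set R) by apply: (bounded_subset _ bB); exact: subIsetl.
have Ile x y : (x <= y)%R -> mu (I x) <= mu (I y).
  move=> xy; apply: le_measure; rewrite ?inE//; apply: setIS => z /=.
  by rewrite !in_itv/= => /le_trans; exact.
pose S := [set y : R | mu (I y) = 0].
have S0 : S (- M - 1)%R.
  rewrite /S/= (_ : I _ = set0) ?measure0// -subset0 => x [/BM].
  by rewrite /= !in_itv/= => /andP[Mx _]; rewrite leNgt ltrBlDr ltr_pwDr.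
have SM y : S y -> (y <= M)%R.
  move=> Sy; rewrite leNgt; apply/negP => My; move: muB.
  suff -> : B = I y by rewrite Sy eqxx.
  rewrite /I setIidl// => x /BM; rewrite /= !in_itv/= => /andP[_].
  by move=> /le_lt_trans/(_ My)/ltW.
have supS : has_sup S by split; [exists (- M - 1)%R|exists M => y /SM].
pose y := sup S.
have IE n : mu (I (y - n.+1%:R^-1)%R) = 0.
  have n0 : (0 < n.+1%:R^-1 :> R)%R by rewrite invr_gt0.
  have [z Sz yz] := sup_adherent n0 supS.
  by apply/eqP; rewrite -measure_le0 -[leRHS]Sz; exact/Ile/ltW.
pose J n := I (y + n.+1%:R^-1)%R.
have mJ : measurable (\bigcap_n J n) by apply: bigcapT_measurable => n; exact: mI.
have muJ : mu (\bigcap_n J n) != 0.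
  apply: integer_valued_bigcap => //.
  - by move=> n; exact: mI.
  - by move=> n; exact: bI.
  - move=> m n mn; apply/subsetPset; apply: setIS => x/=.
    rewrite !in_itv/= => /le_trans; apply; rewrite lerD2l.
    by rewrite lef_pV2 ?posrE ?ltr0n// ler_nat.
  - move=> n; apply/eqP => SJ; have := ub_le_sup supS.2 SJ; rewrite -/y.
    by rewrite gerDl leNgt invr_gt0 ltr0n.
have : mu (B `&` [set y]) != 0.
  apply: contra_neq muJ => By0.
  apply: (@subset_measure_eq0 _ _ _ _ _ ((B `&` [set y]) `|` \bigcup_n I (y - n.+1%:R^-1)%R)) => //.
  - by apply: measurableU; [exact: measurableI|exact: bigcup_measurable].
  - move=> x Jx; have [Bx _] := Jx 0%N Logic.I.
    have xy : (x <= y)%R.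
      rewrite leNgt; apply/negP => /ltr_add_invr[k]; apply/negP.
      rewrite -leNgt.
      by have [_ /=] := Jx k Logic.I; rewrite in_itv.
    move: xy; rewrite le_eqVlt => /predU1P[xy|/ltr_add_invr[k xy]].
      by left; split.
    by right; exists k => //; split => //=; rewrite in_itv/= lerBrDr ltW.
  - rewrite (_ : _ `|` _ = \bigcup_n (if n is k.+1 then I (y - k.+1%:R^-1)%R else B `&` [set y])).
      apply: measure_bigcup_eq0 => [[|n]//|[|n]//].
      exact: measurableI.
    apply/seteqP; split => x.
      by move=> [Bx|[k _ Ik]]; [exists 0%N|exists k.+1].
    by move=> [[|k] _]; [left|right; exists k].
have [By|By] := pselect (B y); last first.
  rewrite (_ : _ `&` _ = set0) ?measure0 ?eqxx// -subset0 => x [+ xy].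
  by rewrite xy.
move=> Bmu; exists y => //; apply: contra_neq Bmu => y0.
apply: subset_measure_eq0 y0 => //; exact: measurableI.
Qed.

End integer_valued_measure.

Section pushm.
Context d d' (T1 : measurableType d) (T2 : measurableType d') (R : realType).

Definition pushm (m : {measure set T1 -> \bar R}) (f : T1 -> T2)
    (mf : measurable_fun setT f) : {measure set T2 -> \bar R} :=
  measure_function_pushforward__canonical__measure_function_Measure m mf.

End pushm.

Section points_of_an_integer_valued_measure.
Context (R : realType) (mu : {measure set (measurableTypeR R) -> \bar R}).
Hypothesis mu_int : integer_valued mu.

Lemma integer_valued_itvNyo_eq0 (s : R) :
  (forall u, (u < s)%R -> mu [set u] = 0) -> mu `]-oo, s[%classic = 0.
Proof.
move=> atom0; rewrite (_ : `]-oo, s[%classic = \bigcup_n `[(s - n%:R)%R, s[%classic).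
  apply: measure_bigcup_eq0 => // n; apply/eqP/negP => /negP.
  move=> /integer_valued_atom[]//; first exact: bounded_set_itv.
  by move=> u /=; rewrite in_itv/= => /andP[_ /atom0 ->]; rewrite eqxx.
apply/seteqP; split => x /=; last first.
  by move=> [n _] /=; rewrite !in_itv/= => /andP[].
rewrite in_itv/= => xs; exists (Num.bound (s - x)) => //=.
by rewrite in_itv/= xs andbT lerBlDl -lerBlDr ltW// archi_boundP// subr_ge0 ltW.
Qed.

(** This replaces the supremum by masses of fixed intervals, from which measurability follows. The
    second disjunct accounts for the default value 0 of [sup] when there is no point before [s]. *)
Lemma last_before_gt (s x : R) : (x < last_before mu s)%R <->
  ((x < s)%R /\ mu `]x, s[%classic != 0) \/
  (mu `]-oo, s[%classic = 0 /\ (x < 0)%R).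
Proof.
rewrite /last_before; set S := (X in sup X).
have S_ub : has_ubound S by exists s => u [/ltW].
have [S0|S0] := pselect (S !=set0); last first.
  have Nys0 : mu `]-oo, s[%classic = 0.
    apply: integer_valued_itvNyo_eq0 => u us.
    by apply: contra_notP S0 => /eqP u0; exists u.
  have -> : sup S = 0%R.
    by apply: sup_out => -[].
  split; first by move=> x0; right.
  case=> [[xs]|[]//]; move/integer_valued_atom => -[]//.
    exact: bounded_set_itv.
  move=> u /=; rewrite in_itv/= => /andP[_ us] u0.
  by exfalso; apply: S0; exists u.
split.
  move=> /(sup_gt S0)[u [us u0] xu]; left; split; first exact: lt_trans us.
  apply: contra_neq u0 => xs0; apply: subset_measure_eq0 xs0 => //.
  by move=> _ ->; rewrite /= in_itv/= xu.
case=> [[xs]|[Nys0 _]].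
  move/integer_valued_atom => -[]//; first exact: bounded_set_itv.
  move=> u /=; rewrite in_itv/= => /andP[xu us] u0.
  by apply: lt_le_trans xu _; apply: ub_le_sup.
have [u [us /eqP[]]] := S0.
by apply: subset_measure_eq0 Nys0 => // _ ->; rewrite /= in_itv/=.
Qed.

Lemma last_before_le (s x : R) : (x < s)%R -> mu `]x, s[%classic = 0 ->
  mu `]-oo, s[%classic != 0 -> (last_before mu s <= x)%R.
Proof.
move=> xs mu0 Ny0; rewrite leNgt; apply/negP => /last_before_gt[[_ /eqP//]|].
by case=> /eqP; rewrite (negbTE Ny0).
Qed.

(** Points cannot accumulate, so the supremum is attained. Both [l < 0] and the mass at [l] come
    from [integer_valued_bigcap], applied to intervals that shrink to the empty set and to [[set l]]
    respectively. *)
Lemma last_before_atom : mu `]-oo, 0%R[%classic != 0 ->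
  [/\ (last_before mu 0 < 0)%R, mu [set last_before mu 0] != 0 &
     mu `]last_before mu 0, 0%R[%classic = 0].
Proof.
move=> Ny0; set l := last_before mu 0.
have Vn0 n : (0 < n.+1%:R^-1 :> R)%R by rewrite invr_gt0.
have Vle m n : (m <= n)%N -> (n.+1%:R^-1 <= m.+1%:R^-1 :> R)%R.
  by move=> mn; rewrite lef_pV2 ?posrE ?ltr0n// ler_nat.
have l0 : (l < 0)%R.
  apply: contrapT => /negP; rewrite -leNgt => l0.
  have := @integer_valued_bigcap _ _ mu_int
    (fun n => `](- n.+1%:R^-1)%R, 0%R[%classic) (fun n => measurable_itv _)
    (fun n => bounded_set_itv _ _ _ _).
  rewrite (_ : \bigcap_n _ = set0) ?measure0 ?eqxx; last first.
    rewrite -subset0 => x Jx; have := Jx 0%N Logic.I.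
    rewrite /= in_itv/= => /andP[_ x0].
    have [k] := ltr_add_invr x0.
    have := Jx k Logic.I; rewrite /= in_itv/= => /andP[+ _] xk.
    by rewrite -subr_gt0 opprK => /lt_trans /(_ xk); rewrite ltxx.
  move=> h; suff : false by []; apply: h => [m n mn|n].
    apply/subsetPset/subset_itv; rewrite bnd_simp//.
    by rewrite lerN2 Vle.
  apply/eqP => J0; move: l0; rewrite leNgt => /negP; apply.
  apply: (@le_lt_trans _ _ (- n.+1%:R^-1)%R); last by rewrite oppr_lt0.
  by apply: last_before_le => //; rewrite oppr_lt0.
have gap : mu `]l, 0%R[%classic = 0.
  apply/eqP/negP => /negP gap0.
  have := (last_before_gt 0 l).2 (or_introl (conj l0 gap0)).
  by rewrite ltxx.
split=> //.
have := @integer_valued_bigcap _ _ mu_int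
    (fun n => `](l - n.+1%:R^-1)%R, l]%classic) (fun n => measurable_itv _)
    (fun n => bounded_set_itv _ _ _ _).
rewrite (_ : \bigcap_n _ = [set l]); last first.
  apply/seteqP; split => [x Jx|_ -> n _] /=; last first.
    by rewrite in_itv/= lexx andbT gtrBl.
  apply/eqP; rewrite eq_le; apply/andP; split.
    by have := Jx 0%N Logic.I; rewrite /= in_itv/= => /andP[].
  rewrite leNgt; apply/negP => /ltr_add_invr[k xk].
  have := Jx k Logic.I; rewrite /= in_itv/= ltrBlDr => /andP[lx _].
  by have := lt_trans lx xk; rewrite ltxx.
apply=> [m n mn|n].
  apply/subsetPset/subset_itv; rewrite bnd_simp//.
  by rewrite lerB// Vle.
apply/eqP => J0.
have ln : (l - n.+1%:R^-1 < l)%R by rewrite gtrBl.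
have /last_before_gt[[_ /eqP]|[/eqP]] := ln; last by rewrite (negbTE Ny0).
pose U : set (measurableTypeR R) := `](l - n.+1%:R^-1)%R, l]%classic `|` `]l, 0%R[%classic.
apply; apply: (@subset_measure_eq0 _ _ _ _ _ U).
- exact: measurable_itv.
- by apply: measurableU; exact: measurable_itv.
- move=> x; rewrite /U/= !in_itv/= => /andP[-> ->]; rewrite andbT/=.
  by have [?|?] := leP x l; [left|right].
- rewrite /U measureU; [by rewrite [X in X + _]J0 add0e|exact: measurable_itv|exact: measurable_itv|].
  apply/seteqP; split => // x [] /=; rewrite !in_itv/= => /andP[_ xl] /andP[lx _].
  by move: lx; rewrite ltNge xl.
Qed.

(** The numbering has [T_0 <= 0 < T_1], so a point at 0, which the Palm measure provides, has index
    0. The interarrival times of index -1 and 0 are then the intervals on either side of the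
    origin. *)
Lemma nth_point0_of_atom : mu [set 0%R] != 0 -> nth_point mu 0 = 0%R.
Proof.
move=> mu0; rewrite /nth_point/=; set S := (X in sup X).
have S0 : S 0%R by split.
apply/eqP; rewrite eq_le; apply/andP; split.
  by apply: ge_sup; [exists 0%R|move=> u []].
by apply: ub_le_sup => //; exists 0%R => u [].
Qed.

Lemma interarrivalN1_of_atom : mu [set 0%R] != 0 ->
  interarrival mu (-1)%Z = (0 - last_before mu 0)%R.
Proof.
move=> mu0; rewrite /interarrival (_ : (-1 + 1)%R = 0%Z)// nth_point0_of_atom//.
by rewrite -[X in last_before mu X](nth_point0_of_atom mu0).
Qed.

Lemma interarrival0_of_atom : mu [set 0%R] != 0 ->
  interarrival mu 0%Z = first_after mu 0.
Proof.
move=> mu0; rewrite /interarrival (_ : (0 + 1)%R = 1%Z)// nth_point0_of_atom//.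
by rewrite subr0 -[X in first_after mu X](nth_point0_of_atom mu0).
Qed.

End points_of_an_integer_valued_measure.

Section measurable_last_before.
Context d (X : measurableType d) (R : realType).
Variable K : X -> {measure set (measurableTypeR R) -> \bar R}.
Hypothesis mK : forall U, measurable U -> measurable_fun setT (K ^~ U).
Hypothesis K_int : forall x, integer_valued (K x).

Lemma measurable_last_before (s : R) : measurable_fun setT (fun x => last_before (K x) s).
Proof.
move=> mT; apply: (measurability _ (RGenOInfty.measurableE R)) => //.
move=> _ [_ [x ->] <-]; rewrite setTI.
rewrite (_ : _ @^-1` _ =
  [set w | (x < s)%R /\ K w `]x, s[%classic != 0] `|`
  [set w | K w `]-oo, s[%classic = 0 /\ (x < 0)%R]); last first.
  apply/seteqP; split => w /=; rewrite in_itv/= andbT => /last_before_gt; exact.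
have mKU U k : measurable U -> measurable [set w | K w U = k].
  move=> mU; rewrite -[X in measurable X]setTI; exact: (mK mU measurableT (emeasurable_set1 k)).
apply: measurableU.
- have [xs|xs] := boolP (x < s)%R; last first.
    by rewrite (_ : [set w | _] = set0)// -subset0 => w [].
  rewrite (_ : [set w | _] = ~` [set w | K w `]x, s[%classic = 0]).
    by apply: measurableC; exact: mKU.
  by apply/seteqP; split => w /=; [move=> [_ /eqP]|move=> /eqP].
- have [x0|x0] := boolP (x < 0)%R; last first.
    by rewrite (_ : [set w | _] = set0)// -subset0 => w [].
  rewrite (_ : [set w | _] = [set w | K w `]-oo, s[%classic = 0]); first exact: mKU.
  by apply/seteqP; split => w /=; [move=> []|].
Qed.

End measurable_last_before.

Section reflection.
Context (R : realType).

Lemma measurable_opp_R : measurable_fun setT (-%R : measurableTypeR R -> measurableTypeR R).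
Proof. exact: oppr_measurable. Qed.

(** Reflection through the origin turns the first point after [s] into the last point before [- s],
    so that the results on [last_before] transfer to [first_after]. *)
Definition reflect_measure (mu : {measure set (measurableTypeR R) -> \bar R}) :=
  pushm mu measurable_opp_R.

Lemma integer_valued_reflect (mu : {measure set (measurableTypeR R) -> \bar R}) :
  integer_valued mu ->
  integer_valued (reflect_measure mu).
Proof.
move=> mu_int B mB [M [Mr MB]]; apply: mu_int.
  by rewrite -[X in measurable X]setTI; exact: measurable_opp_R.
by exists M; split => // x Mx y /= /(MB _ Mx) /=; rewrite normrN.
Qed.

Lemma first_after_reflect (mu : {measure set (measurableTypeR R) -> \bar R}) s :
  first_after mu s = (- last_before (reflect_measure mu) (- s))%R.
Proof.
rewrite /first_after /inf /last_before; congr (- sup _)%R.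
have pN u : (-%R : R -> R) @^-1` [set u] = [set (- u)%R].
  by apply/seteqP; split => v /= => [<-|->]; rewrite opprK.
apply/seteqP; split => u /=.
  by move=> [v [sv v0] <-]; rewrite ltrN2; split => //; rewrite /point_of /pushforward pN opprK.
move=> [us u0]; exists (- u)%R; rewrite ?opprK//; split; first by rewrite ltrNr.
by move: u0; rewrite /point_of /pushforward pN.
Qed.

Lemma first_after_lt (mu : {measure set (measurableTypeR R) -> \bar R}) (s x : R) :
  integer_valued mu ->
  (first_after mu s < x)%R <->
  ((s < x)%R /\ mu `]s, x[%classic != 0) \/
  (mu `]s, +oo[%classic = 0 /\ (0 < x)%R).
Proof.
move=> mu_int; rewrite first_after_reflect ltrNl.
have := last_before_gt (integer_valued_reflect mu_int) (- s) (- x).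
rewrite ltrN2 oppr_lt0 /reflect_measure/= /pushforward.
rewrite opp_preimage_itvbndbnd/= !opprK.
rewrite (_ : -%R @^-1` `]-oo, (- s)%R[%classic = `]s, +oo[%classic)//.
by apply/seteqP; split => u /=; rewrite !in_itv/= andbT ltrN2.
Qed.

End reflection.

Lemma measurable_first_after d (X : measurableType d) (R : realType)
    (K : X -> {measure set (measurableTypeR R) -> \bar R}) (s : R) :
  (forall U, measurable U -> measurable_fun setT (K ^~ U)) ->
  (forall x, integer_valued (K x)) ->
  measurable_fun setT (fun x => first_after (K x) s).
Proof.
move=> mK K_int; under eq_fun do rewrite first_after_reflect.
apply: (measurableT_comp (@measurable_opp_R R)).
apply: (@measurable_last_before _ _ _ (fun x => reflect_measure (K x))) => [U mU|x].
  by apply: mK; rewrite -[X in measurable X]setTI; exact: measurable_opp_R.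
exact: integer_valued_reflect.
Qed.

Section integer_valued_kernel.
Context d (X : measurableType d) (R : realType).
Variable K : X -> {measure set (measurableTypeR R) -> \bar R}.
Hypothesis mK : forall U, measurable U -> measurable_fun setT (fun x => K x U).
Hypothesis K_int : forall x, integer_valued (K x).

Let D (n : nat) : set (measurableTypeR R) := `[(- n%:R)%R, n%:R]%classic.

Let mD n : measurable (D n). Proof. exact: measurable_itv. Qed.

Let ndD : nondecreasing_seq D.
Proof.
move=> m n mn; apply/subsetPset/subset_itv; rewrite bnd_simp.
  by rewrite lerN2 ler_nat.
by rewrite ler_nat.
Qed.

Let UD : \bigcup_n D n = setT.
Proof.
apply/seteqP; split => // x _; exists (Num.bound `|x|%R) => //=.
by rewrite /D/= in_itv/= -ler_norml ltW// archi_boundP.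
Qed.

Let Dfin n x : K x (D n) < +oo.
Proof. by have [k ->] := K_int x (mD n) (bounded_set_itvcc _ _); exact: ltry. Qed.

Lemma measurable_fun_xsection_integer_valued (A : set (X * measurableTypeR R)) :
  measurable A -> measurable_fun setT (fun x => K x (xsection A x)).
Proof. exact: (measurable_fun_xsection_kernel mK mD ndD UD Dfin). Qed.

Lemma measurable_fun_integral_integer_valued (f : X * measurableTypeR R -> \bar R) :
  (forall z, 0 <= f z) -> measurable_fun setT f ->
  measurable_fun setT (fun x => \int[K x]_y f (x, y)).
Proof. exact: (measurable_fun_integral_locally_finite_kernel mK mD ndD UD Dfin). Qed.

Lemma fubini_tonelli_integer_valued d' (Z : measurableType d')
    (m : {sigma_finite_measure set Z -> \bar R})
    (P : {sigma_finite_measure set X -> \bar R})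
    (h : (Z * X) * measurableTypeR R -> \bar R) :
  (forall z, 0 <= h z) -> measurable_fun setT h ->
  \int[m]_z \int[P]_x \int[K x]_y h (z, x, y) =
  \int[P]_x \int[K x]_y \int[m]_z h (z, x, y).
Proof. exact: (fubini_tonelli_kernel mK mD ndD UD Dfin). Qed.

Lemma measurable_pushm_integer_valued d' (Z : measurableType d')
    (h : X * measurableTypeR R -> Z) (U : set Z) :
  measurable_fun setT h -> measurable U ->
  measurable_fun setT (fun x => K x [set y | U (h (x, y))]).
Proof.
move=> mh mU; have mhU : measurable (h @^-1` U).
  by rewrite -[X in measurable X]setTI; exact: mh.
rewrite (_ : (fun x => _) = (fun x => K x (xsection (h @^-1` U) x))).
  exact: measurable_fun_xsection_integer_valued.
apply/funext => x; congr (K x _); apply/seteqP; split => y /=.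
  by move=> Uh; rewrite /xsection/= inE.
by rewrite /xsection/= inE.
Qed.

End integer_valued_kernel.

Lemma eq_measure_of_itvNyc (R : realType)
    (m1 m2 : {measure set (measurableTypeR R) -> \bar R}) :
  m1 setT < +oo -> m1 setT = m2 setT ->
  (forall t, m1 `]-oo, t]%classic = m2 `]-oo, t]%classic) ->
  forall B, measurable B -> m1 B = m2 B.
Proof.
move=> fin1 m12T m12 B mB.
have fin x : m1 `]-oo, x]%classic < +oo.
  by apply: le_lt_trans fin1; rewrite le_measure ?inE.
pose g (n : nat) : set (measurableTypeR R) := `](- n%:R)%R, +oo[%classic.
have GI : setI_closed (@RGenOInfty.G R).
  move=> _ _ [x ->] [y ->]; exists (Num.max x y).
  by apply/seteqP; split => z /=; rewrite !in_itv/= !andbT gt_max => /andP.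
have gG n : RGenOInfty.G (g n) by exists (- n%:R)%R.
have gT : \bigcup_n g n = setT.
  apply/seteqP; split => // x _; exists (Num.bound `|x|%R) => //=.
  rewrite /g/= in_itv/= andbT.
  by rewrite ltrNl; apply: le_lt_trans (archi_boundP (normr_ge0 x)); rewrite -normrN ler_norm.
have m12G A : RGenOInfty.G A -> m1 A = m2 A.
  move=> [x ->]; rewrite -setCitvl/= -!setTD !measureD//= ?setTI ?m12 ?m12T//.
  by rewrite -m12T.
have gfin n : m1 (g n) < +oo.
  by apply: le_lt_trans fin1; rewrite le_measure ?inE//; exact: measurable_itv.
have GE : @measurable _ (measurableTypeR R) = <<s @RGenOInfty.G R >>.
  exact: RGenOInfty.measurableE.
exact (measure_unique _ g GE GI gG gT m1 m2 m12G gfin B mB).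
Qed.

(** * Distribution functions *)

Section distribution_functions.
Context (R : realType) (Q : probability (measurableTypeR R) R).
Local Notation F := (distribution_function Q).

Let fin t : Q `]-oo, t]%classic \is a fin_num.
Proof. by apply: fin_num_measure; exact: measurable_itv. Qed.

Lemma distribution_function_nondecreasing : {homo F : x y / (x <= y)%R}.
Proof.
move=> x y xy; apply: fine_le => //; apply: le_measure; rewrite ?inE; [exact: measurable_itv..|].
by move=> z /=; rewrite !in_itv/= => /le_trans; exact.
Qed.

Lemma measurable_distribution_function :
  measurable_fun setT (F : measurableTypeR R -> R).
Proof. exact: nondecreasing_measurable distribution_function_nondecreasing. Qed.

Lemma distribution_function_le1 t : (F t <= 1)%R.
Proof. by rewrite -lee_fin fineK//; apply: probability_le1; exact: measurable_itv. Qed.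

(** The density of the stationary age for a lifetime of mean 1; the indicator discards negative
    ages. *)
Definition survival t : R :=
  (\1_(`]0%R, +oo[%classic : set (measurableTypeR R)) t * (1 - F t))%R.

Lemma survival_ge0 t : (0 <= survival t)%R.
Proof. by rewrite mulr_ge0// subr_ge0 distribution_function_le1. Qed.

Lemma measurable_survival : measurable_fun setT (survival : measurableTypeR R -> R).
Proof.
apply: measurable_funM; first exact: measurable_indic.
by apply: measurable_funB; [exact: measurable_cst|exact: measurable_distribution_function].
Qed.

Lemma tail_probability t : Q `]t, +oo[%classic = (1 - F t)%:E.
Proof.
rewrite -setCitvl probability_setC; last exact: measurable_itv.
by rewrite EFinB fineK.
Qed.

Lemma tail_probability_small (e : R) : (0 < e)%R -> exists K, (1 - F K < e)%R.
Proof.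
move=> e0; pose J n : set (measurableTypeR R) := `]n%:R, +oo[%classic.
have cJ : Q (J n) @[n --> \oo] --> Q (\bigcap_n J n).
  apply: nonincreasing_cvg_mu.
  - by rewrite -ge0_fin_numE// fin_num_measure//; exact: measurable_itv.
  - by move=> n; exact: measurable_itv.
  - by apply: bigcapT_measurable => n; exact: measurable_itv.
  - move=> m n mn; apply/subsetPset/subset_itv; rewrite bnd_simp//.
    by rewrite ler_nat.
move: cJ; rewrite (_ : \bigcap_n _ = set0) ?measure0; last first.
  rewrite -subset0 => x /(_ (Num.bound `|x|%R) Logic.I).
  rewrite /J/= in_itv/= andbT ltNge => /negP; apply.
  by apply: le_trans (ler_norm _) (ltW (archi_boundP _)).
move/fine_cvgP => [_ /cvgrPdist_lt /(_ e e0)] [n _ /(_ n (leqnn n))].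
rewrite /= sub0r normrN /J tail_probability/= => Ke; exists n%:R.
by apply: le_lt_trans Ke; rewrite ler_norm.
Qed.

Lemma distribution_function_itvoc x y : (x <= y)%R ->
  Q `]x, y]%classic = (F y - F x)%:E.
Proof.
move=> xy; rewrite EFinB !fineK//.
have -> : `]x, y]%classic = `]-oo, y]%classic `\` `]-oo, x]%classic.
  apply/seteqP; split => z /=; rewrite !in_itv/= leNgt.
    by move=> /andP[xz ->]; split => //; apply/negP; rewrite -ltNge.
  by move=> [-> /negP]; rewrite -ltNge => ->.
rewrite measureD//; last by rewrite -ge0_fin_numE//; exact: fin.
congr (_ - Q _); apply/seteqP; split => z /=; rewrite !in_itv/=; first by case.
by move=> zx; split => //; exact: le_trans xy.
Qed.

Lemma continuous_distribution_function (x : R) : Q [set x] = 0 -> {for x, continuous F}.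
Proof.
move=> x0; pose J n : set (measurableTypeR R) := `](x - n.+1%:R^-1)%R, (x + n.+1%:R^-1)%R]%classic.
have Vn0 n : (0 < n.+1%:R^-1 :> R)%R by rewrite invr_gt0.
have cJ : Q (J n) @[n --> \oo] --> Q (\bigcap_n J n).
  apply: nonincreasing_cvg_mu.
  - by rewrite -ge0_fin_numE// fin_num_measure//; exact: measurable_itv.
  - by move=> n; exact: measurable_itv.
  - by apply: bigcapT_measurable => n; exact: measurable_itv.
  - move=> m n mn.
    have Vle : (n.+1%:R^-1 <= m.+1%:R^-1 :> R)%R by rewrite lef_pV2 ?posrE ?ltr0n// ler_nat.
    by apply/subsetPset/subset_itv; rewrite bnd_simp ?lerB ?lerD.
move: cJ; rewrite (_ : \bigcap_n _ = [set x]) ?x0; last first.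
  apply/seteqP; split => [y Jy|_ -> n _]; last first.
    by rewrite /J/= in_itv/= gtrBl lerDl Vn0 ltW.
  apply/eqP; rewrite eq_le; apply/andP; split; rewrite leNgt; apply/negP => /ltr_add_invr[k];
    have := Jy k Logic.I; rewrite /J/= in_itv/= => /andP[ky yk]; apply/negP; rewrite -leNgt//.
  by rewrite -lerBlDr ltW.
move=> cJ; apply/cvgrPdist_lt => e e0.
move/fine_cvgP : cJ => [_ /cvgrPdist_lt /(_ e e0)] [n _ /(_ n (leqnn n))].
rewrite /= sub0r normrN /J distribution_function_itvoc; last first.
  by rewrite (@le_trans _ _ x)// ?gerBl ?lerDl ltW.
move=> /= Jne; near=> y.
have yx : (`|x - y| < n.+1%:R^-1)%R by near: y; exact: cvgr_dist_lt.
apply: le_lt_trans Jne.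
have [xy yx'] : (x - n.+1%:R^-1 <= y)%R /\ (y <= x + n.+1%:R^-1)%R.
  move: yx; rewrite ltr_distl => /andP[h1 h2].
  by split; [rewrite lerBlDr ltW|rewrite -lerBlDr ltW].
have Fxy := distribution_function_nondecreasing xy.
have Fyx := distribution_function_nondecreasing yx'.
have xn : (x - n.+1%:R^-1 <= x)%R by rewrite gerBl ltW.
have nx : (x <= x + n.+1%:R^-1)%R by rewrite lerDl ltW.
have Fxn := distribution_function_nondecreasing xn.
have Fnx := distribution_function_nondecreasing nx.
rewrite ler_norml [X in (_ <= _ <= X)%R]ger0_norm ?subr_ge0; last exact: le_trans Fnx.
by rewrite ger0_norm ?subr_ge0; [apply/andP; split; lra|exact: le_trans Fnx].
Unshelve. all: by end_near. Qed.

(** Discontinuities are atoms, hence countably many, whereas a nonempty open interval has positive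
    Lebesgue measure. The identity is taken as a random variable [X] so as to use the countability
    of the atoms of its law. *)
Lemma exists_continuity_point (a b : R) : (a < b)%R ->
  exists x, [/\ (a < x)%R, (x < b)%R & {for x, continuous F}].
Proof.
move=> ab; apply: contrapT => nex.
pose X : {RV Q >-> R} := HB.pack (fun x : measurableTypeR R => x : R)
  (isMeasurableFun.Build _ _ _ _ (fun x : measurableTypeR R => x : R) (@measurable_id _ _ _)).
have disc : `]a, b[%classic `<=` [set r | 0 < pmf X r]%R.
  move=> x /=; rewrite in_itv/= => /andP[ax xb]; rewrite lt_neqAle pmf_ge0 andbT.
  apply/negP => /eqP/esym p0; apply: nex; exists x; split => //.
  apply: continuous_distribution_function; move: p0; rewrite /pmf.
  rewrite (_ : X @^-1` _ = [set x])// => /eqP.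
  by rewrite fine_eq0 ?fin_num_measure// => /eqP.
have := sub_countable (subset_card_le disc) (pmf_gt0_countable X).
move/countable_lebesgue_measure0; rewrite lebesgue_measure_itv/= lte_fin ab.
by rewrite -EFinB => -[] /eqP; rewrite subr_eq0 gt_eqF.
Qed.

End distribution_functions.

(** * The Palm measure and the law of the age *)

Section palm_measure.
Context (R : realType) d (T : measurableType d).
Variables (P : probability T R) (theta : R -> T -> T).
Variable Phi : R.-ker T ~> measurableTypeR R.
Hypothesis flow : measure_preserving_flow P theta.
Hypothesis pp : point_process Phi.

Let mPhi U : measurable U -> measurable_fun setT (fun w => Phi w U).
Proof. exact: measurable_kernel. Qed.

Let Phi_int w : integer_valued (Phi w).
Proof. exact: pp. Qed.

Lemma measurable_flow : measurable_fun setT (fun z : T * measurableTypeR R => theta z.2 z.1).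
Proof.
have ms : measurable_fun setT (fun z : T * measurableTypeR R => (z.2, z.1)).
  exact: measurable_fun_pair.
exact: (measurableT_comp (flow_measurable flow) ms).
Qed.

Lemma measurable_flow_orbit w : measurable_fun setT (fun s : measurableTypeR R => theta s w).
Proof. exact: (measurableT_comp measurable_flow (pair1_measurable w)). Qed.

Lemma ge0_integral_flow t (f : T -> \bar R) : (forall w, 0 <= f w) ->
  measurable_fun setT f -> \int[P]_w f (theta t w) = \int[P]_w f w.
Proof.
move=> f0 mf; have mt : measurable_fun setT (theta t).
  exact: (measurableT_comp measurable_flow (pair2_measurable t)).
rewrite -(@ge0_integral_pushforward _ _ _ _ _ _ mt P setT)//.
by apply: (eq_measure_integral P) => A mA _; exact: (flow_preserving flow).
Qed.

(** The measure is the mixture over [w] of the images of [Phi w], restricted to []0, 1]], under the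
    orbit map [s |-> theta s w]. It is left unnormalised; its total mass is the intensity. *)
Lemma palm_measure_exists : exists M : {measure set T -> \bar R},
  forall f, (forall w, 0 <= f w) -> measurable_fun setT f ->
  \int[M]_w f w = \int[P]_w \int[Phi w]_(s in `]0%R, 1%R]) f (theta s w).
Proof.
pose D : set (measurableTypeR R) := `]0%R, 1%R]%classic.
have mD : measurable D by exact: measurable_itv.
pose K w := pushm (mrestr (Phi w) mD) (measurable_flow_orbit w).
have mK U : measurable U -> measurable_fun setT (fun w => K w U).
  move=> mU.
  (* Keeping the time as a second component turns the restriction to [D] into membership in a
     product set. *)
  have mh : measurable_fun setT (fun z : T * measurableTypeR R => (theta z.2 z.1, z.2)).
    by apply: measurable_fun_pair => //; exact: measurable_flow.
  apply: (measurable_pushm_integer_valued mPhi Phi_int mh (U := U `*` D)).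
  exact: measurableX.
exists (mixture_measure P mK) => f f0 mf.
rewrite (@integral_mixture _ _ _ _ _ P K)//.
apply: eq_integral => w _; rewrite ge0_integral_pushforward//=.
  rewrite preimage_setT ge0_integral_mrestr//=.
  exact: (measurableT_comp mf (measurable_flow_orbit w)).
exact: measurable_flow_orbit.
Qed.

End palm_measure.

(** * The Campbell-Mecke formula *)

Section campbell_mecke.
Context (R : realType) d (T : measurableType d).
Variables (P : probability T R) (theta : R -> T -> T).
Variable Phi : R.-ker T ~> measurableTypeR R.
Hypothesis flow : measure_preserving_flow P theta.
Hypothesis pp : point_process Phi.
Hypothesis compat : flow_compatible theta Phi.
Variable M : {measure set T -> \bar R}.
Hypothesis ME : forall f, (forall w, 0 <= f w) -> measurable_fun setT f ->
  \int[M]_w f w = \int[P]_w \int[Phi w]_(s in `]0%R, 1%R]) f (theta s w).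

Let mPhi U : measurable U -> measurable_fun setT (fun w => Phi w U).
Proof. exact: measurable_kernel. Qed.

Let Phi_int w : integer_valued (Phi w).
Proof. exact: pp. Qed.

Let D : set (measurableTypeR R) := `]0%R, 1%R]%classic.

Let mD : measurable D. Proof. exact: measurable_itv. Qed.

Let mDR : measurable_fun setT (fun u : measurableTypeR R => (\1_D u)%:E : \bar R).
Proof. by apply/measurable_EFinP; exact: measurable_indic. Qed.

Lemma ge0_integral_Phi_flow t w (f : R -> \bar R) : (forall x, 0 <= f x) ->
  measurable_fun setT (f : measurableTypeR R -> _) ->
  \int[Phi (theta t w)]_u f u = \int[Phi w]_x f (x - t)%R.
Proof.
move=> f0 mf.
have mt : measurable_fun setT (fun x : measurableTypeR R => (x - t)%R : measurableTypeR R).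
  by apply: measurable_funB => //; exact: measurable_cst.
rewrite (@eq_measure_integral _ _ _ setT (pushm (Phi w) mt)); last first.
  by move=> A mA _; rewrite compat.
by rewrite ge0_integral_pushforward.
Qed.

(* Shift the origin by [s] under [P], which is flow invariant, then integrate out
   [s] over the interval of length 1 that it selects. *)
Lemma campbell_mecke (f : measurableTypeR R * T -> \bar R) : (forall z, 0 <= f z) ->
  measurable_fun setT f ->
  \int[@lebesgue_measure R]_s \int[M]_w f (s, w) =
  \int[P]_w \int[Phi w]_u f (u, theta u w).
Proof.
move=> f0 mf; have mfl := measurable_flow flow.
have mg (g : measurableTypeR R * T * measurableTypeR R -> measurableTypeR R) :
    measurable_fun setT g -> measurable_fun setT
    (fun z : measurableTypeR R * T * measurableTypeR R => f (g z, theta z.2 z.1.2)).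
  move=> mg; apply: (measurableT_comp mf); apply: measurable_fun_pair => //.
  apply: (measurableT_comp mfl (g := fun z => (z.1.2, z.2))).
  by apply: measurable_fun_pair => //; exact: measurableT_comp.
have mD2 (g : measurableTypeR R * T * measurableTypeR R -> measurableTypeR R) :
    measurable_fun setT g -> measurable_fun setT (fun z => (\1_D (g z))%:E : \bar R).
  exact: (measurableT_comp mDR).
(* Three forms of the integrand: [h1] comes from the definition of [M], translating [s] by [u] gives
   [h2], and moving the origin by [s] gives [h3], in which [s] occurs in the indicator alone. *)
pose h1 (z : measurableTypeR R * T * measurableTypeR R) :=
  (\1_D z.2)%:E * f (z.1.1, theta z.2 z.1.2).
have h10 z : 0 <= h1 z by rewrite mule_ge0.
have mh1 : measurable_fun setT h1.
  apply: emeasurable_funM; first exact: mD2.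
  by apply: mg; exact: measurableT_comp.
pose h2 (z : measurableTypeR R * T * measurableTypeR R) :=
  (\1_D z.2)%:E * f ((z.2 + z.1.1)%R, theta z.2 z.1.2).
have h20 z : 0 <= h2 z by rewrite mule_ge0.
have mh2 : measurable_fun setT h2.
  apply: emeasurable_funM; first exact: mD2.
  by apply: mg; apply: measurable_funD => //; exact: measurableT_comp.
pose h3 (z : measurableTypeR R * T * measurableTypeR R) :=
  (\1_D (z.2 - z.1.1)%R)%:E * f (z.2, theta z.2 z.1.2).
have h30 z : 0 <= h3 z by rewrite mule_ge0.
have mh3 : measurable_fun setT h3.
  apply: emeasurable_funM; last exact: mg.
  by apply: mD2; apply: measurable_funB => //; exact: measurableT_comp.
have mhs (h : measurableTypeR R * T * measurableTypeR R -> \bar R) w u :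
    measurable_fun setT h -> measurable_fun setT (fun s : measurableTypeR R => h (s, w, u)).
  have ms : measurable_fun setT (fun s : measurableTypeR R => (s, w, u)).
    by apply: measurable_fun_pair => //; exact: measurable_fun_pair.
  by move=> mh; exact: (measurableT_comp mh ms).
have mfs (s : measurableTypeR R) : measurable_fun setT (fun w => f (s, w)).
  exact: (measurableT_comp mf (pair1_measurable s)).
transitivity (\int[@lebesgue_measure R]_s \int[P]_w \int[Phi w]_u h1 (s, w, u)).
  apply: eq_integral => s _; rewrite (ME (fun w => f0 (s, w)) (mfs s)).
  apply: eq_integral => w _; rewrite integral_mkcond; apply: eq_integral => u _.
  by rewrite patchE /h1/= indicE; case: ifPn => _; rewrite ?mul1e ?mul0e.
rewrite (fubini_tonelli_integer_valued mPhi Phi_int _ _ h10 mh1).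
transitivity (\int[P]_w \int[Phi w]_u \int[@lebesgue_measure R]_s h2 (s, w, u)).
  apply: eq_integral => w _; apply: eq_integral => u _; rewrite /h1 /h2/=.
  rewrite (@ge0_integral_affine _ 1%R u)//=; last 2 first.
  - by move=> s; rewrite mule_ge0.
  - exact: mhs mh1.
  by rewrite normr1 mul1e; under eq_integral do rewrite mul1r addrC.
rewrite -(fubini_tonelli_integer_valued mPhi Phi_int _ _ h20 mh2).
transitivity (\int[@lebesgue_measure R]_s \int[P]_w \int[Phi w]_u h3 (s, w, u)).
  apply: eq_integral => t _.
  rewrite -[LHS](ge0_integral_flow flow t); last 2 first.
  - by move=> w; exact: integral_ge0.
  - have mt : measurable_fun setT (fun z : T * measurableTypeR R => (t, z.1, z.2)).
      by apply: measurable_fun_pair => //; exact: measurable_fun_pair.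
    have mh2t := measurableT_comp mh2 mt.
    exact (measurable_fun_integral_integer_valued mPhi Phi_int (fun z => h20 _) mh2t).
  apply: eq_integral => w _; rewrite ge0_integral_Phi_flow//; last first.
    exact: (measurableT_comp mh2 (pair1_measurable (t, theta t w))).
  apply: eq_integral => x _; rewrite /h2 /h3/= subrK.
  by rewrite -(flowD flow) subrK.
rewrite (fubini_tonelli_integer_valued mPhi Phi_int _ _ h30 mh3).
apply: eq_integral => w _; apply: eq_integral => u _; rewrite /h3/=.
rewrite ge0_integralZr//; last first.
  apply: (measurableT_comp mDR).
  by apply: measurable_funB => //; exact: measurable_cst.
rewrite (_ : \int[_]_x _ = 1) ?mul1e//.
rewrite (eq_integral (fun x => (\1_(`[u - 1, u[%classic%R : set (measurableTypeR R)) x)%:E)).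
  rewrite integral_indic//= setIT lebesgue_measure_itv/= lte_fin gtrBl ltr01.
  by rewrite -EFinB opprB addrC subrK.
move=> t _; rewrite !indicE; congr (_%:R%:E); congr nat_of_bool.
have itvE : (0 < u - t <= 1)%R = (u - 1 <= t < u)%R.
  by rewrite subr_gt0 lerBlDr lerBlDr addrC andbC.
by apply/idP/idP => /set_mem; rewrite /D/= in_itv/= => itv; rewrite inE/= in_itv/= ?itvE// -itvE.
Qed.

End campbell_mecke.

(** The mass of [[set s]] is that of a section of the diagonal [y - s = 0], hence measurable in
    [s]. *)
Lemma measurable_atoms (R : realType) (mu : {measure set (measurableTypeR R) -> \bar R}) :
  integer_valued mu -> measurable [set s : measurableTypeR R | mu [set s] = 0].
Proof.
move=> mu_int.
have mh : measurable_fun setT (fun z : measurableTypeR R * measurableTypeR R => (z.2 - z.1)%R : measurableTypeR R).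
  exact: measurable_funB.
have mmu := @measurable_pushm_integer_valued _ (measurableTypeR R) _ (fun=> mu)
  (fun _ _ => measurable_cst _) (fun=> mu_int) _ (measurableTypeR R)
  _ _ mh (measurable_set1 (0%R : R)).
have := mmu measurableT [set 0] (emeasurable_set1 0); rewrite setTI.
congr measurable; apply/seteqP; split => s /=;
  rewrite (_ : [set y | (y - s)%R = 0%R] = [set s])//;
  by apply/seteqP; split => y /= => [/subr0_eq|->]; rewrite ?subrr.
Qed.

(** * The age of one process, under its Palm measure and under the stationary probability *)

Section stationary_process.
Context (R : realType) d (T : measurableType d).
Variables (P : probability T R) (theta : R -> T -> T).
Variable Phi : R.-ker T ~> measurableTypeR R.
Hypothesis flow : measure_preserving_flow P theta.
Hypothesis pp : point_process Phi.
Hypothesis compat : flow_compatible theta Phi.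
Variable lam : R.
Hypothesis lam_gt0 : (0 < lam)%R.
Hypothesis intensityE : intensity P Phi = lam%:E.
Variable M : {measure set T -> \bar R}.
Hypothesis ME : forall f, (forall w, 0 <= f w) -> measurable_fun setT f ->
  \int[M]_w f w = \int[P]_w \int[Phi w]_(s in `]0%R, 1%R]) f (theta s w).

Let mPhi U : measurable U -> measurable_fun setT (fun w => Phi w U).
Proof. exact: measurable_kernel. Qed.

Let Phi_int w : integer_valued (Phi w).
Proof. exact: pp. Qed.

Let lamfin : (0 <= lam)%R. Proof. exact: ltW. Qed.

Lemma palm_measureE A : measurable A ->
  M A = \int[P]_w \int[Phi w]_(s in `]0%R, 1%R]) (\1_A (theta s w))%:E.
Proof.
move=> mA; rewrite -(ME (f := fun w => (\1_A w)%:E)).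
- by rewrite integral_indic// setIT.
- by move=> w; rewrite lee_fin.
- by apply/measurable_EFinP; exact: measurable_indic.
Qed.

Lemma palm_measureT : M setT = lam%:E.
Proof.
rewrite palm_measureE// -intensityE; apply: eq_integral => w _.
rewrite (eq_integral (cst 1)) => [|s _]; last by rewrite indicT.
by rewrite integral_cst ?mul1e//; exact: measurable_itv.
Qed.

(* The sets of interarrival times are identified with measurable ones only on
   configurations having a point at 0, which is all that the Palm measure sees. *)
Lemma palmE A B : measurable B ->
  (forall w, Phi w [set 0%R] != 0 -> A w <-> B w) ->
  palm P theta Phi A = lam^-1%:E * M B.
Proof.
move=> mB AB; rewrite /palm intensityE (palm_measureE mB); congr (_%:E * _).
apply: eq_integral => w _.
(* The times in []0, 1]] that are not points form a null set, since a charged bounded set contains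
   an atom. *)
pose N : set (measurableTypeR R) := `]0%R, 1%R]%classic `&` [set s | Phi w [set s] = 0].
have mN : measurable N.
  by apply: measurableI; [exact: measurable_itv|exact: measurable_atoms].
apply: (@integral_off_null _ _ _ _ _ N) => //.
  apply/eqP/negP => /negP /(integer_valued_atom (Phi_int w) mN)[|s [_ /= ->]].
    by apply: bounded_subset (bounded_set_itv false false 0%R 1%R); exact: subIsetl.
  by rewrite eqxx.
move=> s Ds Ns; rewrite !indicE; congr (_%:R%:E); congr nat_of_bool.
have s0 : Phi (theta s w) [set 0%R] != 0.
  rewrite compat// (_ : [set x : R | [set 0%R] (x - s)%R] = [set s]).
    by apply: contra_notN Ns => /eqP s0; split.
  by apply/seteqP; split => y /= => [/subr0_eq|->]; rewrite ?subrr.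
by apply/idP/idP; rewrite !inE => /(AB _ s0).
Qed.

Variable F0 : probability (measurableTypeR R) R.
Hypothesis interE : interarrival_distribution P theta Phi
  (fun t => distribution_function F0 (lam * t)).

(** [Z] is a measurable stand-in for the interarrival time, equal to it when there is a point at 0.
    The interarrival distribution gives the law on half-lines, and two finite measures of equal
    total mass that agree there are equal. *)
Lemma palm_interarrival (k : int) (Z : T -> R) (B : set (measurableTypeR R)) :
  measurable_fun setT (Z : T -> measurableTypeR R) ->
  (forall w, Phi w [set 0%R] != 0 -> interarrival (Phi w) k = Z w) ->
  measurable B -> M [set w | B (lam * Z w)%R] = lam%:E * F0 B.
Proof.
move=> mZ ZE; have mlZ : measurable_fun setT (fun w => (lam * Z w)%R : measurableTypeR R).
  by apply: measurable_funM => //; exact: measurable_cst.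
apply: (@eq_measure_of_itvNyc _ (pushm M mlZ) (mscale (NngNum lamfin) F0)).
- by rewrite /= /pushforward preimage_setT palm_measureT ltry.
- rewrite /= /pushforward preimage_setT palm_measureT /mscale/=.
  by rewrite probability_setT mule1.
- move=> t; rewrite /= /pushforward /mscale/=.
  have := interE k (t / lam)%R.
  rewrite (@palmE _ [set w | (Z w <= t / lam)%R]); last 2 first.
  + rewrite -[X in measurable X]setTI.
    have := mZ measurableT `]-oo, (t / lam)%R]%classic (measurable_itv _).
    by congr measurable; congr setI; apply/seteqP; split => w /=; rewrite in_itv.
  + by move=> w /ZE /= ->.
  rewrite (mulrCA lam t) divff ?gt_eqF// mulr1 /distribution_function fineK; last first.
    exact: fin_num_measure.
  move=> <-; rewrite muleA -EFinM divff ?gt_eqF// mul1e.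
  congr (M _); apply/seteqP; split => w /=.
    by rewrite in_itv/= ler_pdivlMr// mulrC.
  by rewrite in_itv/= ler_pdivlMr// mulrC.
Qed.

Definition age (w : T) : R := (0 - last_before (Phi w) 0)%R.

Lemma measurable_age : measurable_fun setT (age : T -> measurableTypeR R).
Proof.
apply: measurable_funB; first exact: measurable_cst.
exact: measurable_last_before.
Qed.

Lemma palm_age B : measurable B ->
  M [set w | B (lam * age w)%R] = lam%:E * F0 B.
Proof.
apply: (@palm_interarrival (-1)%Z) => [|w w0]; first exact: measurable_age.
exact: interarrivalN1_of_atom.
Qed.

Lemma palm_first_after B : measurable B ->
  M [set w | B (lam * first_after (Phi w) 0)%R] = lam%:E * F0 B.
Proof.
apply: (@palm_interarrival 0%Z) => [|w w0]; first exact: measurable_first_after.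
exact: interarrival0_of_atom.
Qed.

Hypothesis F0_pos : F0 `]-oo, 0%R]%classic = 0.
Hypothesis F0_atomless : forall x, F0 [set x] = 0.

(** An empty []0, u[] means that the next point is at [u] or later, or that there is none. In the
    latter case [first_after] takes its default value 0, which has Palm measure 0 because [F0] does
    not charge []-oo, 0]]; the absence of atoms then identifies the closed tail with the open
    one. *)
Lemma palm_gap (u : R) : (0 < u)%R ->
  M [set w | Phi w `]0%R, u[%classic = 0] =
  (lam * (1 - distribution_function F0 (lam * u)))%:E.
Proof.
move=> u0.
have mE (U : set (measurableTypeR R)) : measurable U -> measurable [set w | Phi w U = 0].
  move=> mU; have := mPhi mU measurableT (emeasurable_set1 0).
  by rewrite setTI.
have mfa U : measurable U -> measurable [set w | U (lam * first_after (Phi w) 0)%R].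
  move=> mU; rewrite -[X in measurable X]setTI.
  have mf : measurable_fun setT (fun w => (lam * first_after (Phi w) 0)%R : measurableTypeR R).
    by apply: measurable_funM; [exact: measurable_cst|exact: measurable_first_after].
  exact: mf.
pose E := [set w | Phi w `]0%R, +oo[%classic = 0].
have E0 : M E = 0.
  apply: (@subset_measure_eq0 _ _ _ _ _ [set w | `]-oo, 0%R]%classic (lam * first_after (Phi w) 0)%R]).
  - by apply: mE; exact: measurable_itv.
  - by apply: mfa; exact: measurable_itv.
  - move=> w Ew /=; rewrite in_itv/= pmulr_rle0// leNgt; apply/negP => fa0.
    have [_ /(_ (or_intror (conj Ew fa0)))] :=
      first_after_lt 0 (first_after (Phi w) 0) (Phi_int w).
    by rewrite ltxx.
  - by rewrite palm_first_after ?F0_pos ?mule0.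
have -> : [set w | Phi w `]0%R, u[%classic = 0] =
    [set w | `[(lam * u)%R, +oo[%classic (lam * first_after (Phi w) 0)%R] `|` E.
  apply/seteqP; split => w /=; rewrite in_itv/= andbT ler_pM2l//.
  - move=> w0; have [fau|] := leP u (first_after (Phi w) 0); first by left.
    by move=> /(first_after_lt _ _ (Phi_int w))[[_]|[]]; [rewrite w0 eqxx|right].
  - case=> [fau|Ew].
      apply/eqP/negP => /negP w0; move: fau; rewrite leNgt => /negP; apply.
      by apply/(first_after_lt _ _ (Phi_int w)); left.
    apply: (subset_measure_eq0 _ _ _ (Ew : Phi w `]0%R, +oo[%classic = 0)).
    - exact: measurable_itv.
    - exact: measurable_itv.
    - by move=> x /=; rewrite !in_itv/= => /andP[->].
have mI : measurable [set w | `[(lam * u)%R, +oo[%classic (lam * first_after (Phi w) 0)%R].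
  by apply: mfa; exact: measurable_itv.
have mEE : measurable E by apply: mE; exact: measurable_itv.
have -> : M ([set w | `[(lam * u)%R, +oo[%classic (lam * first_after (Phi w) 0)%R] `|` E) =
    M [set w | `[(lam * u)%R, +oo[%classic (lam * first_after (Phi w) 0)%R].
  apply/eqP; rewrite eq_le; apply/andP; split; last first.
    rewrite le_measure ?inE//; first exact: measurableU.
  by rewrite -[leRHS]adde0 -[X in _ + X]E0; exact: measureU2.
rewrite palm_first_after; last exact: measurable_itv.
rewrite EFinM; congr (_ * _).
rewrite -setCitvl probability_setC; last exact: measurable_itv.
rewrite EFinB /distribution_function fineK; last first.
  by apply: fin_num_measure; exact: measurable_itv.
congr (_ - _).
rewrite (_ : `]-oo, (lam * u)%R]%classic = `]-oo, (lam * u)%R[%classic `|` [set (lam * u)%R]).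
  rewrite measureU//=; first by rewrite [X in _ = _ + X]F0_atomless adde0.
  by apply/seteqP; split => // x [] /= /[swap] ->; rewrite in_itv/= ltxx.
apply/seteqP; split => x /=; rewrite !in_itv/= le_eqVlt.
  by move=> /orP[/eqP|]; [right|left].
by case=> [->|->]; rewrite ?eqxx ?orbT.
Qed.

Hypothesis simple : simple_process P Phi.
Hypothesis F0_mean : \int[@lebesgue_measure R]_(t in `]0%R, +oo[)
  (1 - distribution_function F0 t)%:E = 1.

Let measurable_eq0 (U : set (measurableTypeR R)) : measurable U ->
  measurable [set w | Phi w U = 0].
Proof.
by move=> mU; have := mPhi mU measurableT (emeasurable_set1 0); rewrite setTI.
Qed.

(** The last point [l] before 0 is the only point of [Phi w] that can lie in the set, and simplicity
    gives it mass exactly 1. The other elements of the set lie in the gap []l, 0[], which is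
    null. *)
Lemma integral_last_point w (B : set (measurableTypeR R)) :
  (forall x, Phi w [set x] <= 1) ->
  \int[Phi w]_u (\1_[set u | [/\ (u < 0)%R, B (- u)%R & Phi w `]u, 0%R[%classic = 0]] u)%:E =
  (\1_[set w | Phi w `]-oo, 0%R[%classic != 0 /\ B (age w)] w)%:E.
Proof.
move=> simp; have [Ny0|Ny0] := eqVneq (Phi w `]-oo, 0%R[%classic) 0.
  pose N : set (measurableTypeR R) := `]-oo, 0%R[%classic.
  rewrite (integral_off_null (N := N) (g := cst 0))//.
  - by rewrite integral0 indicE memNset// => -[]; rewrite Ny0 eqxx.
  - exact: measurable_itv.
  - by move=> x _; rewrite /N/= in_itv/= => x0; rewrite indicE memNset// => -[].
have [l0 atom gap] := last_before_atom (Phi_int w) Ny0.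
have ageN : age w = (- last_before (Phi w) 0)%R by rewrite /age sub0r.
move: l0 atom gap ageN; set l := last_before _ _ => l0 atom gap ageN.
pose N : set (measurableTypeR R) := `]l, 0%R[%classic.
rewrite (integral_off_null (N := N)
  (g := fun u => (\1_(if pselect (B (age w)) then [set l] else set0) u)%:E))//; last 2 first.
- exact: measurable_itv.
- move=> u _; rewrite /N/= in_itv/= => lu0; rewrite !indicE; congr (_%:R%:E); congr nat_of_bool.
  apply/idP/idP; rewrite !inE/=.
    move=> [u0 Bu u0gap]; have ul : u = l.
      move/negP: lu0; rewrite u0 andbT -leNgt le_eqVlt => /predU1P[//|ul].
      move/eqP : atom; case; apply: (subset_measure_eq0 _ _ _ u0gap) => //.
      by move=> _ -> /=; rewrite in_itv/= ul.
    by case: pselect => //; rewrite ageN -ul.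
  by case: pselect => // Bl ->; split => //; rewrite -ageN.
case: pselect => Bl; last first.
  by rewrite indic0 integral0 indicE memNset// => -[].
rewrite integral_indic// setIT indicE mem_set//.
by apply/eqP; rewrite eq_le simp/=; apply: (integer_valued_ge1 (Phi_int w)) => //;
  apply: bounded_subset (bounded_set_itvcc l l) => _ ->; rewrite /= in_itv/= lexx.
Qed.

(** Seen from a point [u < 0], being the last point before 0 means having no point in []0, - u[], an
    event whose Palm measure is given by [palm_gap]. The substitution [t = - lam * s] absorbs the
    factor [lam] and makes the age positive. *)
Let stationary_age_aux (B : set (measurableTypeR R)) : measurable B ->
  P ([set w | Phi w `]-oo, 0%R[%classic != 0] `&` [set w | B (lam * age w)%R]) =
  \int[@lebesgue_measure R]_t ((survival F0 t)%:E * (\1_B t)%:E).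
Proof.
move=> mB; set E := _ `&` _.
have mlage : measurable_fun setT (fun w => (lam * age w)%R : measurableTypeR R).
  by apply: measurable_funM; [exact: measurable_cst|exact: measurable_age].
have mE : measurable E.
  apply: measurableI; last by rewrite -[X in measurable X]setTI; exact: mlage.
  rewrite (_ : [set w | _] = ~` [set w | Phi w `]-oo, 0%R[%classic = 0]).
    by apply: measurableC; apply: measurable_eq0; exact: measurable_itv.
  by apply/seteqP; split => w /= /eqP.
pose A : set (measurableTypeR R * T) := [set z |
  [/\ (z.1 < 0)%R, B (lam * - z.1)%R & Phi z.2 `]0%R, (- z.1)%R[%classic = 0]].
have mA : measurable A.
  have m1 : measurable [set z : measurableTypeR R * T | (z.1 < 0)%R].
    have := @measurable_fst _ _ (measurableTypeR R) T.
    move=> /(_ measurableT `]-oo, 0%R[%classic (measurable_itv _)).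
    by rewrite setTI; congr measurable; apply/seteqP; split => z /=; rewrite in_itv.
  have m2 : measurable [set z : measurableTypeR R * T | B (lam * - z.1)%R].
    have mf : measurable_fun setT (fun z : measurableTypeR R * T =>
        (lam * - z.1)%R : measurableTypeR R).
      apply: measurable_funM; first exact: measurable_cst.
      by apply: (measurableT_comp (@measurable_opp_R R)).
    by rewrite -[X in measurable X]setTI; exact: mf.
  have m3 : measurable [set z : measurableTypeR R * T | Phi z.2 `]0%R, (- z.1)%R[%classic = 0].
    have mK U : measurable U -> measurable_fun setT (fun z : measurableTypeR R * T => Phi z.2 U).
      by move=> mU; exact: (measurableT_comp (mPhi mU)).
    have mh : measurable_fun setT (fun z : (measurableTypeR R * T) * measurableTypeR R =>
        (z.2, (z.2 + z.1.1)%R) : measurableTypeR R * measurableTypeR R).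
      apply: measurable_fun_pair => //; apply: measurable_funD => //.
      exact: measurableT_comp.
    have mU : measurable ((`]0%R, +oo[%classic : set (measurableTypeR R)) `*`
        (`]-oo, 0%R[%classic : set (measurableTypeR R))).
      by apply: measurableX; exact: measurable_itv.
    have := measurable_pushm_integer_valued mK (fun z => Phi_int z.2) mh mU.
    move=> /(_ measurableT _ (emeasurable_set1 0)); rewrite setTI.
    congr measurable; apply/seteqP; split => z /=; rewrite (_ : [set y | _ /\ _] =
      `]0%R, (- z.1)%R[%classic)//; apply/seteqP; split => y /=;
      by rewrite !in_itv/= andbT -[(y < - _)%R]subr_gt0 -[(_ + _ < 0)%R]oppr_gt0 opprD addrC => /andP.
  by have := measurableI _ _ (measurableI _ _ m1 m2) m3; congr measurable;
    apply/seteqP; split => z /= [] => [[]|].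
have mf : measurable_fun setT (fun z => (\1_A z)%:E : \bar R).
  by apply/measurable_EFinP; exact: measurable_indic.
have /(_ _)/= CM := campbell_mecke flow pp compat ME _ mf.
transitivity (\int[P]_w \int[Phi w]_u (\1_A (u, theta u w))%:E).
  rewrite -[E]setIT -integral_indic//.
  have [N [mN N0 sN]] := simple.
  apply: (integral_off_null mN N0) => //.
    by move=> w; exact: integral_ge0.
  move=> w _ Nw; have simp x : Phi w [set x] <= 1.
    by move: x; apply: contrapT => /sN.
  rewrite -(integral_last_point [set x | B (lam * x)%R] simp).
  apply: eq_integral => u _; rewrite !indicE; congr (_%:R%:E); congr nat_of_bool.
  have gapE : Phi (theta u w) `]0%R, (- u)%R[%classic = Phi w `]u, 0%R[%classic.
    rewrite compat; last exact: measurable_itv.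
    congr (Phi w _); apply/seteqP; split => x /=; rewrite !in_itv/= subr_gt0.
      by rewrite ltrBlDr addNr.
    by rewrite ltrBlDr addNr.
  apply/idP/idP => /set_mem[u0 Bu gu]; apply/mem_set; split => //=.
    by rewrite gapE.
  by rewrite -gapE.
rewrite -CM//.
rewrite [RHS](@ge0_integral_affine _ (- lam)%R 0%R); last 3 first.
- by rewrite oppr_eq0 gt_eqF.
- by move=> t; rewrite mule_ge0// lee_fin survival_ge0.
- by apply: emeasurable_funM; apply/measurable_EFinP;
  [exact: measurable_survival|exact: measurable_indic].
rewrite normrN gtr0_norm// -ge0_integralZl//; last 2 first.
- have mg : measurable_fun setT (fun t : measurableTypeR R => (survival F0 t)%:E * (\1_B t)%:E : \bar R).
    by apply: emeasurable_funM; apply/measurable_EFinP;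
  [exact: measurable_survival|exact: measurable_indic].
  exact: (measurableT_comp mg (measurable_affine _ _)).
- by move=> t _; rewrite mule_ge0// lee_fin survival_ge0.
apply: eq_integral => s _; rewrite addr0 mulNr -mulrN.
have mAs : measurable [set w | A (s, w)].
  by have := measurable_xsection s mA; congr measurable; apply/seteqP; split => w;
    rewrite /xsection/= inE.
rewrite (_ : (fun w => _) = (fun w => (\1_[set w | A (s, w)] w)%:E)); last first.
  by apply/funext => w; rewrite !indicE; congr (_%:R%:E); congr nat_of_bool;
    apply/idP/idP; rewrite !inE.
rewrite integral_indic// setIT /survival !indicE.
have [s0|s0] := ltP s 0%R; last first.
  rewrite (_ : [set w | _] = set0) ?measure0; last first.
    by rewrite -subset0 => w [] /=; rewrite ltNge s0.
  rewrite memNset ?mul0r ?mul0e ?mule0//= in_itv/= andbT.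
  by rewrite pmulr_rgt0// oppr_gt0 ltNge s0.
rewrite (mem_set (_ : `]0%R, +oo[%classic (lam * - s)%R)); last first.
  by rewrite /= in_itv/= andbT pmulr_rgt0// oppr_gt0.
rewrite mul1r; have [Bs|Bs] := pselect (B (lam * - s)%R); last first.
  rewrite (_ : [set w | _] = set0) ?measure0; last first.
    by rewrite -subset0 => w [].
  by rewrite memNset// !mule0.
rewrite (mem_set Bs) mule1 (_ : [set w | _] = [set w | Phi w `]0%R, (- s)%R[%classic = 0]).
  by rewrite palm_gap ?oppr_gt0// EFinM.
by apply/seteqP; split => w /= => [[]|].
Qed.

(* Apply [campbell_mecke] to the last point before 0, of which there is exactly one
   when there is a point before 0 at all. *)
Lemma stationary_age (B : set (measurableTypeR R)) : measurable B ->
  P [set w | B (lam * age w)%R] =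
  \int[@lebesgue_measure R]_t ((survival F0 t)%:E * (\1_B t)%:E).
Proof.
move=> mB; rewrite -stationary_age_aux//.
pose E := [set w | Phi w `]-oo, 0%R[%classic = 0].
have mE : measurable E by apply: measurable_eq0; exact: measurable_itv.
have EC : [set w | Phi w `]-oo, 0%R[%classic != 0] = ~` E.
  by apply/seteqP; split => w /= /eqP.
have mB' : measurable [set w | B (lam * age w)%R].
  have mlage : measurable_fun setT (fun w => (lam * age w)%R : measurableTypeR R).
    by apply: measurable_funM; [exact: measurable_cst|exact: measurable_age].
  by rewrite -[X in measurable X]setTI; exact: mlage.
(* For [B] the whole line the right-hand side is the integral of the tail of [F0], which is 1. Hence
   there is almost surely a point before 0, and the default value of [last_before] has no weight. *)
have PE : P E = 0.
  have := stationary_age_aux measurableT.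
  rewrite (_ : [set w | _] `&` _ = ~` E); last by rewrite -EC setIT.
  rewrite probability_setC//.
  rewrite (_ : \int[_]_t _ = 1); last first.
    rewrite -[RHS]F0_mean [RHS]integral_mkcond; apply: eq_integral => t _.
    rewrite indicT mule1 patchE /survival indicE; case: ifPn => _; by rewrite ?mul1r ?mul0r.
  have /fineK <- : P E \is a fin_num by exact: fin_num_measure.
  rewrite -EFinB => -[] /eqP; rewrite subr_eq addrC -subr_eq subrr => /eqP <-.
  by [].
rewrite EC setIC -setDE.
have P0 : P ([set w | B (lam * age w)%R] `&` E) = 0.
  apply: (subset_measure_eq0 _ mE _ PE); first exact: measurableI.
  exact: subIsetr.
rewrite measureD//; last by rewrite -ge0_fin_numE// fin_num_measure.
by apply/esym; rewrite [X in _ - X = _]P0 sube0.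
Qed.

End stationary_process.

(** * Independence of the other processes *)

Section independence_integral.
Context d d1 d2 (T : measurableType d) (T1 : measurableType d1) (T2 : measurableType d2).
Context (R : realType) (P : probability T R) (phi1 : T -> T1) (phi2 : T -> T2).
Hypothesis mphi1 : measurable_fun setT phi1.
Hypothesis mphi2 : measurable_fun setT phi2.
Hypothesis indep : forall A B, measurable A -> measurable B ->
  P (phi1 @^-1` A `&` phi2 @^-1` B) = P (phi1 @^-1` A) * P (phi2 @^-1` B).

Let sf d' (T' : measurableType d') (phi : T -> T') (mphi : measurable_fun setT phi) :
  sigma_finite setT (pushm P mphi).
Proof.
apply: fin_num_fun_sigma_finite; first by rewrite measure0.
by apply: lty_fin_num_fun; rewrite /= /pushforward preimage_setT probability_setT ltry.
Qed.

(** By independence the joint law of [phi1] and [phi2] is the product of their laws, to which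
    Tonelli applies. *)
Lemma ge0_integral_independent (g : T1 * T2 -> \bar R) : (forall z, 0 <= g z) ->
  measurable_fun setT g ->
  \int[P]_w g (phi1 w, phi2 w) = \int[P]_w1 \int[P]_w2 g (phi1 w1, phi2 w2).
Proof.
move=> g0 mg; pose m1 := sigma_finite_measure_of (sf mphi1).
pose m2 := sigma_finite_measure_of (sf mphi2).
have m12 : measurable_fun setT (fun w => (phi1 w, phi2 w)) by exact: measurable_fun_pair.
rewrite -(ge0_integral_pushforward m12 P measurableT mg)//.
rewrite -(@eq_measure_integral _ _ _ setT (pushm P m12) (m1 \x m2)); last first.
  by move=> A mA _; apply: product_measure_unique => // X Y mX mY; rewrite /= /pushforward/= -indep.
rewrite fubini_tonelli1//.
rewrite (@ge0_integral_pushforward _ _ _ _ _ _ mphi1 P setT)//.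
- apply: eq_integral => w1 _ /=.
  rewrite /fubini_F (@ge0_integral_pushforward _ _ _ _ _ _ mphi2 P setT)//.
  exact: (measurableT_comp mg (pair1_measurable _)).
- exact: measurable_fun_fubini_tonelli_F.
- by move=> x _; exact: integral_ge0.
Qed.

End independence_integral.

Section sigma_algebras_of_processes.
Context (R : realType) d (T : measurableType d) (P : probability T R) (N : nat).
Variable Phi : 'I_N -> R.-ker T ~> measurableTypeR R.
Hypothesis indep : independent_processes P Phi.

Lemma sigma_of_measurable i A : sigma_of (Phi i) A -> measurable A.
Proof.
apply: smallest_sub; first exact: sigma_algebra_measurable.
move=> _ [B [V [mB mV ->]]]; rewrite -[X in measurable X]setTI.
exact: (measurable_kernel (Phi i) B mB).
Qed.

Lemma sigma_ofT i : sigma_of (Phi i) setT.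
Proof. by rewrite /sigma_of; exact: (@measurableT _ (g_sigma_algebraType _)). Qed.

(** A pi-system that generates the joint sigma-algebra of the processes other than [i]. *)
Definition other_events (i : 'I_N) : set (set T) :=
  [set B | exists2 A : 'I_N -> set T, (forall j, j != i -> sigma_of (Phi j) (A j)) &
    B = [set w | forall j, j != i -> A j w]].

Lemma other_events_setI i : setI_closed (other_events i).
Proof.
move=> _ _ [A sA ->] [A' sA' ->]; exists (fun j => A j `&` A' j).
  move=> j ji; exact: (@measurableI _ (g_sigma_algebraType _) _ _ (sA j ji) (sA' j ji)).
apply/seteqP; split => w /=; first by move=> [wA wA'] j ji; split; [exact: wA|exact: wA'].
by move=> wAA'; split => j /wAA'[].
Qed.

Lemma other_eventsT i : other_events i setT.
Proof.
exists (fun=> setT); first by move=> j _; exact: sigma_ofT.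
by apply/seteqP; split.
Qed.

Lemma other_events_measurable i : other_events i `<=` measurable.
Proof.
move=> _ [A sA ->]; rewrite (_ : [set w | _] = \bigcap_(j in [set j | j != i]) A j).
  apply: fin_bigcap_measurable => [|j /sA]; last exact: sigma_of_measurable.
  exact: finite_finset.
by apply/seteqP; split => w.
Qed.

Lemma sigma_of_other_events i j A : j != i -> sigma_of (Phi j) A -> other_events i A.
Proof.
move=> ji sA; exists (fun k => if k == j then A else setT).
  by move=> k _; case: eqP => [->//|_]; exact: sigma_ofT.
apply/seteqP; split => w /=; first by move=> wA k _; case: ifP.
by move=> /(_ j ji); rewrite eqxx.
Qed.

(** For fixed [A], both sides are finite measures in [B], so it suffices to compare them on the
    pi-system. There, independence is used twice, over all indices and over all but [i], and the two
    products differ by the factor [P A]. *)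
Lemma independent_other_events i A B : sigma_of (Phi i) A -> <<s other_events i >> B ->
  P (A `&` B) = P A * P B.
Proof.
move=> sA; have mA := sigma_of_measurable sA.
pose m1 := mrestr P mA.
have PA0 : (0 <= fine (P A))%R by exact: fine_ge0.
pose m2 := mscale (NngNum PA0) P.
suff m12 : forall E, <<s other_events i >> E -> m1 E = m2 E.
  move=> /m12; rewrite /m1/m2/= /mrestr/mscale/= setIC => ->.
  by rewrite fineK// fin_num_measure.
apply: (@g_sigma_algebra_measure_unique _ _ _ _ (@other_events_measurable i) (fun=> setT)).
- by move=> _; exact: other_eventsT.
- by apply/seteqP; split => // w _; exists 0%N.
- exact: other_events_setI.
- move=> _ [A' sA' ->]; rewrite /m1/m2/= /mrestr/mscale/=.
  pose A1 j := if j == i then A else A' j.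
  have sA1 j : sigma_of (Phi j) (A1 j).
    by rewrite /A1; case: eqVneq => [->//|]; exact: sA'.
  have := @indep [set: 'I_N]%SET A1 (fun j _ => sA1 j).
  have := @indep [set~ i]%SET A1 (fun j _ => sA1 j).
  rewrite (_ : [set w | _] = [set w | forall j, j != i -> A' j w]); last first.
    apply/seteqP; split => w /= wA j; have := wA j; rewrite /A1 finset.in_setC1.
      by move=> + ji; rewrite ji (negbTE ji); exact.
    by case: eqVneq => //.
  move=> ->; rewrite (_ : [set w | _] = [set w | forall j, j != i -> A' j w] `&` A); last first.
    apply/seteqP; split => w /= wA.
      split; last by have := wA i; rewrite /A1 finset.in_setT eqxx; exact.
      by move=> j ji; have := wA j; rewrite /A1 finset.in_setT (negbTE ji); exact.
    by move=> j _; rewrite /A1; case: eqVneq => [_|ji]; [exact: wA.2|exact: wA.1].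
  move=> PE; transitivity (\prod_(j in [set: 'I_N]%SET) P (A1 j)); first exact: PE.
  rewrite (bigD1 i) ?finset.in_setT//= {1}/A1 eqxx fineK ?fin_num_measure//.
  by congr (_ * _); apply: eq_bigl => j; rewrite finset.in_setT finset.in_setC1.
- move=> _; rewrite /m1/= /mrestr setTI.
  by rewrite -ge0_fin_numE// fin_num_measure.
Qed.

End sigma_algebras_of_processes.

Lemma measurable_invr (R : realType) : measurable_fun setT (@GRing.inv R).
Proof.
move=> _; apply: (measurability _ (RGenOInfty.measurableE R)) => //.
move=> _ [_ [a ->] <-]; rewrite setTI.
have mM : measurable_fun setT (fun x : R => a * x)%R by exact: mulrl_measurable.
have mMlt b : measurable [set x : R | (a * x < b)%R].
  have := mM measurableT `]-oo, b[%classic (measurable_itv _).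
  by rewrite setTI; congr measurable; apply/seteqP; split => x /=; rewrite in_itv.
have mMgt b : measurable [set x : R | (b < a * x)%R].
  have := mM measurableT `]b, +oo[%classic (measurable_itv _).
  by rewrite setTI; congr measurable; apply/seteqP; split => x /=; rewrite in_itv/= andbT.
(* The pieces are [x > 0], [x = 0] and [x < 0]; the middle one reflects the convention that the
   inverse of 0 is 0. *)
rewrite (_ : _ @^-1` _ = (`]0%R, +oo[%classic `&` [set x | (a * x < 1)%R]) `|`
  ((if (a < 0)%R then [set 0%R] else set0) `|`
   (`]-oo, 0%R[%classic `&` [set x | (1 < a * x)%R]))).
  apply: measurableU; first by apply: measurableI => //; exact: measurable_itv.
  apply: measurableU; first by case: ifP.
  by apply: measurableI => //; exact: measurable_itv.
apply/seteqP; split => x /=; rewrite !in_itv/= !andbT.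
  have [x0|x0|->] := ltgtP x 0%R.
  - by rewrite -(ltr_nM2r x0) mulVf ?lt_eqF//; right; right.
  - by rewrite -(ltr_pM2r x0) mulVf ?gt_eqF//; left.
  - by rewrite invr0 => ->; right; left.
case=> [[x0]|[]].
- by move=> ax; rewrite -(ltr_pM2r x0) mulVf ?gt_eqF.
- by case: ifP => // a0 ->; rewrite invr0.
- by move=> [x0 ax]; rewrite -(ltr_nM2r x0) mulVf ?lt_eqF.
Qed.

(** * The stochastic intensity identity *)

Section lifetime_distribution.
Context (R : realType) (F0 : probability (measurableTypeR R) R) (f0 : R -> R).
Hypothesis F0_nonneg : F0 `]-oo, 0%R[%classic = 0.
Hypothesis F0_density : density F0 f0.
Local Notation F := (distribution_function F0).
Local Notation leb := (@lebesgue_measure R).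

Lemma density_atomless x : F0 [set x] = 0.
Proof. by have [_ _ ->//] := F0_density; rewrite integral_set1. Qed.

Lemma density_itvNyc : F0 `]-oo, 0%R]%classic = 0.
Proof.
rewrite (_ : `]-oo, 0%R]%classic = `]-oo, 0%R[%classic `|` [set 0%R]).
  rewrite measureU//=; first by rewrite F0_nonneg [X in _ + X]density_atomless adde0.
  by apply/seteqP; split => // x [] /= /[swap] ->; rewrite in_itv/= ltxx.
apply/seteqP; split => x /=; rewrite !in_itv/= le_eqVlt.
  by move=> /orP[/eqP|]; [right|left].
by case=> [->|->]; rewrite ?eqxx ?orbT.
Qed.

Lemma ge0_integral_lifetime (H : R -> \bar R) : (forall t, 0 <= H t) ->
  measurable_fun setT (H : measurableTypeR R -> _) ->
  \int[F0]_t H t = \int[leb]_t ((f0 t)%:E * H t).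
Proof.
move=> H0 mH; have [mf f_ge0 FE] := F0_density.
apply: (@ge0_integral_density _ _ _ leb F0 f0 f_ge0 mf _ H H0 mH) => U mU.
apply: etrans (FE U mU) _; rewrite [LHS]integral_mkcond.
apply: eq_integral => t _; rewrite patchE indicE.
by case: ifPn => _; rewrite ?mule1 ?mule0.
Qed.

Lemma measurable_hazard_rate :
  measurable_fun setT (hazard_rate F0 f0 : measurableTypeR R -> R).
Proof.
have [mf _ _] := F0_density; apply: measurable_funM => //.
apply: (measurableT_comp (f := fun x : R => x^-1%R)).
  exact: measurable_invr.
by apply: measurable_funB; [exact: measurable_cst|exact: measurable_distribution_function].
Qed.

Lemma hazard_rate_ge0 t : (0 <= hazard_rate F0 f0 t)%R.
Proof.
have [_ f_ge0 _] := F0_density.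
by rewrite /hazard_rate divr_ge0// subr_ge0 distribution_function_le1.
Qed.

(** On this set the hazard rate divides by 0. There is no mass beyond any of its elements, so [F0]
    does not charge the part of it above its infimum, and the infimum is not an atom. *)
Lemma distribution_function_eq1_null : F0 [set t | F t = 1%R] = 0.
Proof.
set S := (X in F0 X).
have mS : measurable S.
  have := measurable_distribution_function F0 measurableT (measurable_set1 1%R).
  by rewrite setTI.
have tail0 y : S y -> F0 `]y, +oo[%classic = 0.
  by rewrite /S/= tail_probability => ->; rewrite subrr.
have [S0|S0] := pselect (S !=set0); last first.
  by move/set0P/negP/negPn/eqP : S0 => ->; rewrite measure0.
have S_lb : has_lbound S.
  exists 0%R => y Sy; rewrite leNgt; apply/negP => y0.
  have : F0 `]-oo, y]%classic = 0.
    apply: (subset_measure_eq0 _ _ _ F0_nonneg); [exact: measurable_itv..|].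
    by move=> x /=; rewrite !in_itv/= => /le_lt_trans; exact.
  move: Sy; rewrite /S/= /distribution_function => + E; rewrite E/= => /eqP.
  by rewrite eq_sym oner_eq0.
pose U n : set (measurableTypeR R) := if n is k.+1 then `](inf S + k.+1%:R^-1)%R, +oo[%classic
  else [set inf S].
have mU n : measurable (U n) by case: n => [|n]; [exact: measurable_set1|exact: measurable_itv].
apply: (@subset_measure_eq0 _ _ _ _ _ (\bigcup_n U n)) => //.
- exact: bigcup_measurable.
- move=> t St; have : (inf S <= t)%R by exact: ge_inf.
  rewrite le_eqVlt => /predU1P[<-|/ltr_add_invr[k kt]]; first by exists 0%N.
  by exists k.+1 => //=; rewrite in_itv/= kt.
- apply: measure_bigcup_eq0 => // -[|k]; first exact: density_atomless.
  have k0 : (0 < k.+1%:R^-1 :> R)%R by rewrite invr_gt0.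
  have [y Sy yk] := inf_adherent k0 (conj S0 S_lb).
  apply: (subset_measure_eq0 _ _ _ (tail0 y Sy)); [exact: measurable_itv..|].
  by move=> x /=; rewrite !in_itv/= !andbT; exact: lt_trans.
Qed.

(** The density factors as survival times hazard rate off [N]. On [N] the survival function vanishes
    while [f0] need not, so [N] is first removed as a null set of [F0]. *)
Lemma integral_lifetime_hazard (H : R -> \bar R) : (forall t, 0 <= H t) ->
  measurable_fun setT (H : measurableTypeR R -> _) ->
  \int[F0]_t H t = \int[leb]_t ((survival F0 t)%:E * ((hazard_rate F0 f0 t)%:E * H t)).
Proof.
move=> H0 mH.
pose N : set (measurableTypeR R) := `]-oo, 0%R]%classic `|` [set t | F t = 1%R].
have mS : measurable [set t : measurableTypeR R | F t = 1%R].
  have := measurable_distribution_function F0 measurableT (measurable_set1 1%R).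
  by rewrite setTI.
have mN : measurable N by apply: measurableU => //; exact: measurable_itv.
have N0 : F0 N = 0.
  apply/eqP; rewrite -measure_le0; apply: le_trans (measureU2 _ _ mS) _.
    exact: measurable_itv.
  by rewrite [X in X + _]density_itvNyc [X in _ + X]distribution_function_eq1_null adde0.
rewrite (integral_off_null mN N0 (g := fun t => (\1_(~` N) t)%:E * H t))//.
- rewrite ge0_integral_lifetime.
  + apply: eq_integral => t _; rewrite !muleA; congr (_ * _).
    rewrite -!EFinM; congr EFin; rewrite /survival /hazard_rate !indicE.
    have [t0|t0] := leP t 0%R.
      rewrite (@memNset _ (~` N)); last by case; left; rewrite /= in_itv.
      by rewrite (@memNset _ `]0%R, +oo[%classic) ?mulr0 ?mul0r//= in_itv/= andbT ltNge t0.
    have tpos : t \in (`]0%R, +oo[%classic : set R).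
      by apply/mem_set; rewrite /= in_itv/= t0.
    rewrite tpos.
    have [F1|F1] := eqVneq (F t) 1%R.
      rewrite (@memNset _ (~` N)); last by case; right.
      by rewrite F1 subrr !(mulr0, mul0r).
    rewrite mem_set; last by move=> [/=|]; [rewrite in_itv/= leNgt t0|exact/eqP].
    by rewrite mulr1 mul1r mulrC divfK// subr_eq0 eq_sym.
  + by move=> t; rewrite mule_ge0// lee_fin.
  + apply: emeasurable_funM => //; apply/measurable_EFinP.
    by apply: measurable_indic; exact: measurableC.
- by move=> t; rewrite mule_ge0// lee_fin.
- by move=> t _ Nt; rewrite indicE mem_set// mul1e.
Qed.

Hypothesis F0_mean : \int[F0]_x x%:E = 1.

Lemma integral_survival : \int[leb]_(t in `]0%R, +oo[) (1 - F t)%:E = 1.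
Proof.
(* The tail formula for the mean is applied to a variable that is nonnegative everywhere; truncating
   at 0 alters the identity on a null set of [F0]. *)
pose X0 (x : measurableTypeR R) : R := Num.max x 0%R.
have mX : measurable_fun setT X0.
  by apply: measurable_maxr => //; exact: measurable_cst.
pose X : {RV F0 >-> R} := HB.pack X0 (isMeasurableFun.Build _ _ _ _ X0 mX).
have X_ge0 x : (0 <= X x)%R by rewrite /X/= le_max lexx orbT.
have := ge0_expectation_ccdf X_ge0; rewrite expectation_def.
rewrite (_ : \int[F0]_x (X x)%:E = 1); last first.
  rewrite -F0_mean; apply: ae_eq_integral => //; first exact/measurable_EFinP.
  exists `]-oo, 0%R[%classic; split; [exact: measurable_itv|exact: F0_nonneg|].
  move=> x /= hx; rewrite in_itv/= ltNge; apply/negP => x0; apply: hx => _.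
    by rewrite /X/= /X0 (elimT max_idPl).
move=> E1; apply: etrans (esym E1); rewrite -integral_itv_obnd_cbnd; last first.
  apply/measurable_funTS.
  exact: ccdf_measurable.
apply: eq_integral => t; rewrite inE/= in_itv/= andbT => t0.
rewrite -tail_probability /ccdf /distribution /pushforward; congr (F0 _).
apply/seteqP; split => x /=; rewrite !in_itv/= !andbT /X/= /X0 lt_max.
  by move=> ->.
by rewrite (ltNge t 0%R) (ltW t0) orbF.
Qed.

End lifetime_distribution.

Section observed_hazard_law.
Context (R : realType) d (T : measurableType d).
Variables (P : probability T R) (theta : R -> T -> T).
Variable Phi : R.-ker T ~> measurableTypeR R.
Variables (F0 : probability (measurableTypeR R) R) (f0 : R -> R) (lam : R).
Hypothesis F0_nonneg : F0 `]-oo, 0%R[%classic = 0.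
Hypothesis F0_density : density F0 f0.
Hypothesis F0_mean : \int[F0]_x x%:E = 1.
Hypothesis flow : measure_preserving_flow P theta.
Hypothesis pp : point_process Phi.
Hypothesis simple : simple_process P Phi.
Hypothesis compat : flow_compatible theta Phi.
Hypothesis lam_gt0 : (0 < lam)%R.
Hypothesis intensityE : intensity P Phi = lam%:E.
Hypothesis interE : interarrival_distribution P theta Phi
  (fun t => distribution_function F0 (lam * t)).
Variable M : {measure set T -> \bar R}.
Hypothesis ME : forall f, (forall w, 0 <= f w) -> measurable_fun setT f ->
  \int[M]_w f w = \int[P]_w \int[Phi w]_(s in `]0%R, 1%R]) f (theta s w).

Let Y w : measurableTypeR R := (lam * age Phi w)%R.

Let mY : measurable_fun setT Y.
Proof.
apply: measurable_funM; first exact: measurable_cst.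
exact: measurable_age.
Qed.

Let hz := hazard_rate F0 f0.

(** The two laws of the scaled age differ by the hazard rate, and the total mass [lam] of [M]
    completes it into the scaled hazard rate. *)
Lemma palm_intensity_exchange (G : R -> \bar R) : (forall x, 0 <= G x) ->
  measurable_fun setT (G : measurableTypeR R -> _) ->
  \int[M]_w G (scaled_hazard_rate F0 f0 lam (age Phi w)) =
  \int[P]_w ((scaled_hazard_rate F0 f0 lam (age Phi w))%:E *
    G (scaled_hazard_rate F0 f0 lam (age Phi w))).
Proof.
move=> G0 mG; have lam0 := ltW lam_gt0.
have mhz : measurable_fun setT (hz : measurableTypeR R -> R) := measurable_hazard_rate F0_density.
have mlhz : measurable_fun setT (fun y : measurableTypeR R => (lam * hz y)%R).
  by apply: measurable_funM => //; exact: measurable_cst.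
have mGhz : measurable_fun setT (fun y : measurableTypeR R => G (lam * hz y)%R).
  exact: (measurableT_comp mG mlhz).
have lhz0 y : (0 <= lam * hz y)%R by rewrite mulr_ge0// hazard_rate_ge0.
transitivity (lam%:E * \int[F0]_y G (lam * hz y)%R).
  rewrite -[LHS]/(\int[M]_w ((fun y => G (lam * hz y)%R) \o Y) w).
  rewrite -[LHS](ge0_integral_pushforward mY M measurableT mGhz)//.
  rewrite -[RHS](@ge0_integral_mscale _ _ _ F0 setT measurableT (NngNum lam0))//.
  apply: eq_measure_integral => B mB _.
  exact: (palm_age pp compat lam_gt0 intensityE ME interE).
rewrite (integral_lifetime_hazard F0_nonneg F0_density)//.
pose h y := (lam * hz y)%:E * G (lam * hz y)%R.
have h0 y : 0 <= h y by rewrite mule_ge0// lee_fin.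
have mh : measurable_fun setT (h : measurableTypeR R -> _).
  by apply: emeasurable_funM => //; exact/measurable_EFinP.
rewrite -[RHS]/(\int[P]_w (h \o Y) w).
rewrite -[RHS](ge0_integral_pushforward mY P measurableT mh)//.
rewrite (@ge0_integral_density _ _ _ lebesgue_measure (pushm P mY) (survival F0))//.
- rewrite -ge0_integralZl//.
  + apply: eq_integral => t _; rewrite /h muleCA; congr (_ * _).
    by rewrite EFinM; exact: muleA.
  + apply: emeasurable_funM; first by apply/measurable_EFinP; exact: measurable_survival.
    by apply: emeasurable_funM => //; exact/measurable_EFinP.
  + move=> t _; rewrite mule_ge0// ?lee_fin ?survival_ge0//.
    by rewrite mule_ge0// lee_fin hazard_rate_ge0.
- by move=> t; exact: survival_ge0.
- exact: measurable_survival.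
- move=> B mB.
  apply: (stationary_age flow pp compat lam_gt0 intensityE ME interE) => //.
  + exact: density_itvNyc F0_density.
  + exact: density_atomless F0_density.
  + exact: integral_survival F0_nonneg F0_mean.
Qed.

End observed_hazard_law.

(** The set of dominators takes finitely many values, and each value is prescribed by finitely many
    comparisons. *)
Lemma measurable_strict_dominators d (X : measurableType d) (R : realType) (N : nat)
    (i : 'I_N) (x : X -> R) (y : 'I_N -> X -> R) (p : pred {set 'I_N}) :
  measurable_fun setT x -> (forall j, j != i -> measurable_fun setT (y j)) ->
  measurable [set z | p [set j | (j != i) && (x z < y j z)%R]%SET].
Proof.
move=> mx my.
rewrite (_ : [set z | _] = \bigcup_(A in [set A : {set 'I_N} | p A])
    \bigcap_(j in [set: 'I_N]) [set z | (j \in A) = (j != i) && (x z < y j z)%R]).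
  apply: fin_bigcup_measurable => [|A _]; first exact: finite_finset.
  apply: fin_bigcap_measurable => [|j _]; first exact: finite_finset.
  have [->|ji] := eqVneq j i.
    case: (i \in A) => /=.
      by rewrite (_ : [set z | _] = set0)// -subset0 => z.
    by rewrite (_ : [set z | _] = setT)//; apply/seteqP; split.
  have := measurable_fun_ltr mx (my j ji).
  move=> /(_ measurableT [set (j \in A)] Logic.I); rewrite setTI.
  by congr measurable; apply/seteqP; split => z /= ->.
apply/seteqP; split => z /=.
  move=> pz; exists [set j | (j != i) && (x z < y j z)%R]%SET => // j _ /=.
  by rewrite finset.inE.
move=> [A pA zA]; rewrite (_ : [set j | _]%SET = A)//.
by apply/setP => j; rewrite finset.inE (zA j Logic.I).
Qed.

(** * Exchange for one item in the presence of the independent others *)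

Section exchange.
Context (R : realType) d (T : measurableType d).
Variables (P : probability T R) (theta : R -> T -> T).
Variables (F0 : probability (measurableTypeR R) R) (f0 : R -> R).
Variables (N : nat) (lam : 'I_N -> R) (Phi : 'I_N -> R.-ker T ~> measurableTypeR R).
Hypothesis F0_nonneg : F0 `]-oo, 0%R[%classic = 0.
Hypothesis F0_density : density F0 f0.
Hypothesis F0_mean : \int[F0]_x x%:E = 1.
Hypothesis flow : measure_preserving_flow P theta.
Hypothesis lam_gt0 : forall i, (0 < lam i)%R.
Hypothesis renewal : forall i, stationary_renewal_process P theta (Phi i).
Hypothesis intensityE : forall i, intensity P (Phi i) = (lam i)%:E.
Hypothesis interE : forall i, interarrival_distribution P theta (Phi i)
  (fun t => distribution_function F0 (lam i * t)).
Hypothesis indep : independent_processes P Phi.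

Local Notation X := (observed_hazard F0 f0 lam Phi).

Let pp i : point_process (Phi i). Proof. by have [] := renewal i. Qed.

Let compat i : flow_compatible theta (Phi i). Proof. by have [] := renewal i. Qed.

Let mPhi i U : measurable U -> measurable_fun setT (fun w => Phi i w U).
Proof. exact: measurable_kernel. Qed.

Let Phi_int i w : integer_valued (Phi i w).
Proof. exact: pp. Qed.

Lemma observed_hazard_ge0 i w : (0 <= X i w)%R.
Proof. by apply: mulr_ge0; [exact/ltW|exact: hazard_rate_ge0]. Qed.

Lemma measurable_scaled_hazard i : measurable_fun setT
  (fun t : measurableTypeR R => scaled_hazard_rate F0 f0 (lam i) t).
Proof.
apply: measurable_funM; first exact: measurable_cst.
apply: (measurableT_comp (measurable_hazard_rate F0_density)).
exact: mulrl_measurable.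
Qed.

Lemma measurable_observed_hazard i : measurable_fun setT (X i).
Proof.
apply: (measurableT_comp (measurable_scaled_hazard i)).
exact: measurable_age.
Qed.

Lemma measurable_sub_algebra_process (G : set (set T)) j (U : set (measurableTypeR R)) :
  sigma_of (Phi j) `<=` <<s G >> -> measurable U ->
  measurable_fun setT (fun w : g_sigma_algebraType G => Phi j w U).
Proof.
move=> sG mU _ V mV; rewrite setTI; apply: sG; apply: sub_sigma_algebra.
by exists U, V.
Qed.

(** The flow need not be measurable for a sub-sigma-algebra. Compatibility avoids it: the shifted
    process gives [U] the mass that the original one gives to [U] translated by the time, which
    depends on process [j] alone. *)
Lemma measurable_observed_hazard_shift (G : set (set T)) j :
  sigma_of (Phi j) `<=` <<s G >> ->
  measurable_fun setT (fun z : measurableTypeR R * g_sigma_algebraType G =>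
    X j (theta z.1 z.2)).
Proof.
move=> sG; apply: (measurableT_comp (measurable_scaled_hazard j)).
apply: measurable_funB; first exact: measurable_cst.
apply: (@measurable_last_before _ _ _
  (fun z : measurableTypeR R * g_sigma_algebraType G => Phi j (theta z.1 z.2))) => [U mU|z].
  rewrite (_ : (fun z => _) = (fun z : measurableTypeR R * g_sigma_algebraType G =>
      Phi j z.2 [set x : measurableTypeR R | U (x - z.1)%R])); last first.
    by apply/funext => z; rewrite compat.
  apply: (measurable_pushm_integer_valued
    (K := fun z : measurableTypeR R * g_sigma_algebraType G => Phi j z.2) _ _
    (h := fun z => (z.2 - z.1.1)%R)) => // [V mV|].
    exact: (measurableT_comp (measurable_sub_algebra_process sG mV)).
  by apply: measurable_funB => //; exact: measurableT_comp.
exact: Phi_int.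
Qed.

Let gen i := [set A | exists (B : set (measurableTypeR R)) (V : set (\bar R)),
  [/\ measurable B, measurable V & A = [set w | V (Phi i w B)]]].

(** [T1 i] and [T2 i] are the same space with the sigma-algebra of process [i] and that of the
    others. Independence becomes a statement about the identity maps into them. *)
Let T1 i := g_sigma_algebraType (gen i).
Let T2 i := g_sigma_algebraType (other_events Phi i).

Let mid1 i : measurable_fun setT (id : T -> T1 i).
Proof. by move=> _ A sA; rewrite setTI; exact: (sigma_of_measurable (Phi := Phi) sA). Qed.

Let mid2 i : measurable_fun setT (id : T -> T2 i).
Proof.
move=> _ A sA; rewrite setTI; move: A sA; apply: smallest_sub.
  exact: sigma_algebra_measurable.
by move=> B oB; apply: (other_events_measurable oB).
Qed.

Let sub2 i j : j != i -> sigma_of (Phi j) `<=` <<s other_events Phi i >>.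
Proof. by move=> ji A sA; apply: sub_sigma_algebra; exact: sigma_of_other_events ji sA. Qed.

Let mX0 (G : set (set T)) j : sigma_of (Phi j) `<=` <<s G >> ->
  measurable_fun setT (fun w : g_sigma_algebraType G => X j w).
Proof.
move=> /measurable_observed_hazard_shift mX.
have m0 : measurable_fun setT (fun w : g_sigma_algebraType G => (0%R : measurableTypeR R, w)).
  by apply: measurable_fun_pair => //; exact: measurable_cst.
have := measurableT_comp mX m0; congr measurable_fun; apply/funext => w /=.
by rewrite (flow0 flow).
Qed.

Let q i (p : pred {set 'I_N}) (x : R) (w : T) : bool :=
  p [set j | (j != i) && (x < X j w)%R]%SET.

(** At a point [s] of process [i], the comparison involves the others shifted by [s]. Independence
    lets them be read off a second outcome, invariance of [P] cancels the shift there, the exchange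
    for a single process applies to what remains, and independence merges the two outcomes again. *)
Lemma palm_exchange i (p : pred {set 'I_N}) (M : {measure set T -> \bar R}) :
  (forall f, (forall w, 0 <= f w) -> measurable_fun setT f ->
    \int[M]_w f w = \int[P]_w \int[Phi i w]_(s in `]0%R, 1%R]) f (theta s w)) ->
  let Q := [set w | p [set j | (j != i) && (X i w < X j w)%R]%SET] in
  M Q = \int[P]_w ((X i w)%:E * (\1_Q w)%:E).
Proof.
move=> ME Q; have [_ simple _ _] := renewal i.
pose D : set (measurableTypeR R) := `]0%R, 1%R]%classic.
pose ind (b : bool) : \bar R := (b%:R)%:E.
have ind0 b : 0 <= ind b by rewrite lee_fin.
have mind d' (Z : measurableType d') (b : Z -> bool) :
    measurable [set z | b z] -> measurable_fun setT (fun z => ind (b z)).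
  move=> mb; rewrite (_ : (fun z => _) = (fun z => (\1_[set z | b z] z)%:E)).
    by apply/measurable_EFinP; exact: measurable_indic.
  apply/funext => z; rewrite indicE /ind; congr (_%:R%:E); congr nat_of_bool.
  by apply/idP/idP => [bz|/set_mem//]; exact/mem_set.
have mX := measurable_observed_hazard.
have mQ : measurable Q by exact: measurable_strict_dominators.
pose G x := \int[P]_w ind (q i p x w).
have mRT : measurable_fun setT (fun z : measurableTypeR R * T => ind (q i p z.1 z.2)).
  apply: mind; apply: measurable_strict_dominators => [|j _]; first exact: measurable_fst.
  exact: measurableT_comp.
have mG : measurable_fun setT (G : measurableTypeR R -> _).
  by apply: (measurable_fun_fubini_tonelli_F (m2 := P)) mRT _ => z; exact: ind0.
have G0 x : 0 <= G x by exact: integral_ge0.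
(* The first outcome drives the other processes and the second one drives process [i]; on the
   diagonal this is the integrand that defines [M Q]. *)
pose h (z : T * T * measurableTypeR R) : \bar R :=
  (\1_D z.2)%:E * ind (q i p (X i (theta z.2 z.1.2)) (theta z.2 z.1.1)).
have h0 z : 0 <= h z by rewrite mule_ge0.
have mh21 : measurable_fun setT (h : T2 i * T1 i * measurableTypeR R -> \bar R).
  apply: emeasurable_funM.
    apply/measurable_EFinP; apply: measurableT_comp => //.
    by apply: measurable_indic; exact: measurable_itv.
  apply: mind; apply: measurable_strict_dominators => [|j ji].
    apply: (measurableT_comp (@measurable_observed_hazard_shift (gen i) i (fun _ => id))
      (g := fun z : T2 i * T1 i * measurableTypeR R => (z.2, z.1.2))).
    by apply: measurable_fun_pair => //; exact: measurableT_comp.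
  apply: (measurableT_comp (measurable_observed_hazard_shift (sub2 ji))
    (g := fun z : T2 i * T1 i * measurableTypeR R => (z.2, z.1.1))).
  by apply: measurable_fun_pair => //; exact: measurableT_comp.
have mhT : measurable_fun setT h.
  have m11 : measurable_fun setT (fun z : T * T * measurableTypeR R => z.1.1).
    exact: measurableT_comp.
  have m12 : measurable_fun setT (fun z : T * T * measurableTypeR R => z.1.2).
    exact: measurableT_comp.
  have m2 := measurableT_comp (@mid2 i) m11.
  have m1 := measurableT_comp (@mid1 i) m12.
  have m21 := measurable_fun_pair m2 m1.
  exact: (measurableT_comp mh21 (measurable_fun_pair m21 measurable_snd)).
have indep12 A B : measurable (A : set (T1 i)) -> measurable (B : set (T2 i)) ->
    P ((id : T -> T1 i) @^-1` A `&` (id : T -> T2 i) @^-1` B) =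
    P ((id : T -> T1 i) @^-1` A) * P ((id : T -> T2 i) @^-1` B).
  by move=> sA sB; exact: (independent_other_events indep sA sB).
have indep21 B A : measurable (B : set (T2 i)) -> measurable (A : set (T1 i)) ->
    P ((id : T -> T2 i) @^-1` B `&` (id : T -> T1 i) @^-1` A) =
    P ((id : T -> T2 i) @^-1` B) * P ((id : T -> T1 i) @^-1` A).
  by move=> sB sA; rewrite setIC muleC; exact: (independent_other_events indep sA sB).
(* [G x] is the probability of [Q] given [X i = x]; both sides are averages of it. *)
transitivity (\int[P]_w ((X i w)%:E * G (X i w))).
  transitivity (\int[P]_w \int[Phi i w]_s h (w, w, s)).
    rewrite (palm_measureE ME mQ); apply: eq_integral => w _.
    rewrite [LHS]integral_mkcond; apply: eq_integral => s _.
    rewrite patchE /h/= !indicE -/D; case: ifPn => sD; rewrite ?sD ?(negbTE sD) ?mul0e ?mul1e//.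
    congr (_%:R%:E); congr nat_of_bool.
    by apply/idP/idP => [/set_mem//|qs]; exact/mem_set.
  pose g (z : T2 i * T1 i) := \int[Phi i z.2]_s h (z, s).
  have mg : measurable_fun setT g.
    apply: (measurable_fun_integral_integer_valued
      (K := fun z : T2 i * T1 i => Phi i z.2) _ _ h0 mh21) => [U mU|z]; last exact: Phi_int.
    have mU1 : measurable_fun setT (fun w : T1 i => Phi i w U).
      exact: measurable_sub_algebra_process.
    exact: (measurableT_comp mU1).
  have g0 z : 0 <= g z by exact: integral_ge0.
  rewrite -[LHS]/(\int[P]_w g (id w, id w)).
  rewrite (ge0_integral_independent (@mid2 i) (@mid1 i) indep21 g0 mg) /g/=.
  rewrite (fubini_tonelli_integer_valued (@mPhi i) (@Phi_int i) P P h0 mhT).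
  transitivity (\int[M]_w G (X i w)); last first.
    exact: (palm_intensity_exchange F0_nonneg F0_density F0_mean flow (pp i) simple
      (compat i) (lam_gt0 i) (intensityE i) (interE i) ME G0 mG).
  have mGX : measurable_fun setT (fun w => G (X i w)).
    exact: (measurableT_comp (f := (G : measurableTypeR R -> \bar R)) mG (mX i)).
  rewrite (ME _ (fun w => G0 (X i w)) mGX).
  apply: eq_integral => w _; rewrite [RHS]integral_mkcond; apply: eq_integral => s _.
  rewrite patchE -/D /h/= indicE; case: ifPn => sD; last first.
    by rewrite (eq_integral (cst 0)) ?integral0// => w' _; rewrite mul0e.
  under eq_integral do rewrite mul1e.
  rewrite (ge0_integral_flow flow s (f := fun w' => ind (q i p (X i (theta s w)) w')))//.
  exact: (measurableT_comp mRT (pair1_measurable _)).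
pose g (z : T1 i * T2 i) := (X i z.1)%:E * ind (q i p (X i z.1) z.2).
have mX1 : measurable_fun setT (fun w : T1 i => X i w) by apply: mX0.
have mg : measurable_fun setT g.
  apply: emeasurable_funM.
    by apply/measurable_EFinP; apply: (measurableT_comp mX1).
  apply: mind; apply: measurable_strict_dominators => [|j ji].
    exact: (measurableT_comp mX1).
  exact: (measurableT_comp (mX0 (sub2 ji))).
have g0 z : 0 <= g z by rewrite mule_ge0// lee_fin observed_hazard_ge0.
transitivity (\int[P]_w g (id w, id w)).
  rewrite (ge0_integral_independent (@mid1 i) (@mid2 i) indep12 g0 mg).
  apply: eq_integral => w1 _; rewrite /g/= ge0_integralZl//; last first.
    by rewrite lee_fin observed_hazard_ge0.
  exact: (measurableT_comp mRT (pair1_measurable _)).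
apply: eq_integral => w _; rewrite /g/= indicE; congr (_ * _); congr (_%:R%:E).
by congr nat_of_bool; apply/idP/idP => [qs|/set_mem//]; exact/mem_set.
Qed.

End exchange.

(** * Comparison of the two policies *)

Section largest_values.
Context (R : realDomainType) (I : finType) (x : I -> R) (A : {set I}).
Hypothesis A_top : forall i j, i \in A -> j \notin A -> (x j <= x i)%R.

Lemma sum_notin_top_le (B : {set I}) : #|A| = #|B| ->
  (\sum_(i | i \notin A) x i <= \sum_(i | i \notin B) x i)%R.
Proof.
move=> AB; have [A0|[a aA]] := set_0Vmem A.
  by move/esym: AB; rewrite A0 cards0 => /eqP; rewrite cards_eq0 => /eqP ->.
(* Subtracting a threshold [t] separating [A] from its complement makes the
   comparison termwise. *)
pose t := x [arg min_(i < a in A) x i]%O.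
have [tA tAC] : (forall i, i \in A -> t <= x i)%R /\ (forall i, i \notin A -> x i <= t)%R.
  by rewrite /t; case: arg_minP => // i iA imin; split => // j; exact: A_top.
have shift (D : {set I}) :
    (\sum_(i | i \notin D) x i = \sum_(i | i \notin D) (x i - t) + t *+ #|~: D|)%R.
  have -> : #|~: D| = #|[pred i | i \notin D]| by apply: eq_card => i; rewrite !finset.inE.
  by rewrite big_split/= sumr_const mulNrn subrK.
rewrite !shift; have -> : #|~: A| = #|~: B| by rewrite [LHS]cardsCs [RHS]cardsCs !finset.setCK AB.
rewrite lerD2r.
rewrite [leLHS]big_mkcond [leRHS]big_mkcond/=; apply: ler_sum => i _.
case: (boolP (i \in A)) => iA; case: (boolP (i \in B)) => iB //=.
  by rewrite subr_ge0 tA.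
by rewrite subr_le0 tAC.
Qed.

Let dominators i := [set j | (j != i) && (x i < x j)%R]%SET.

(** Without ties at [i], every element of [A] dominates [i] strictly. The converse that follows
    tolerates ties. *)
Lemma card_strict_dominators i : i \notin A -> (forall j, j != i -> x i != x j) ->
  (#|A| <= #|dominators i|)%N.
Proof.
move=> iA xi; apply/subset_leq_card/fintype.subsetP => j jA.
have ji : j != i by apply: contraNneq iA => <-.
by rewrite finset.inE ji lt_neqAle xi// A_top.
Qed.

(** If [i] were in [A], so would be its strict dominators, and together with [i] they would exceed
    the size of [A]. *)
Lemma strict_dominators_notin_top i : (#|A| <= #|dominators i|)%N -> i \notin A.
Proof.
move=> Ai; apply/negP => iA.
have : dominators i \subset A.
  apply/fintype.subsetP => j; rewrite finset.inE => /andP[_ xij].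
  by apply: contraLR xij => jA; rewrite -leNgt A_top.
move=> /(conj iA)/andP; rewrite -finset.sub1set -finset.subUset => /subset_leq_card.
by rewrite cardsU1 finset.inE eqxx/= add1n ltnNge Ai.
Qed.

End largest_values.

(** * The static policy *)

Section static_policy_asymptotics.
Context (R : realType) (L : probability (measurableTypeR R) R).
Variables (C : nat -> nat) (lam : forall N, 'I_N -> R) (c : R).
Local Notation F := (distribution_function L).
Hypothesis L_limit : weakly_converges (fun N => empirical_distribution (@lam N)) L.
Hypothesis L_mean : \int[L]_(x in `[0%R, +oo[) x%:E = +oo.
Hypothesis lam_gt0 : forall N, (1 < N)%N -> forall i : 'I_N, (0 < lam i)%R.
Hypothesis lam_sorted : forall N, (1 < N)%N ->
  forall i j : 'I_N, (i <= j)%N -> (lam j <= lam i)%R.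
Hypothesis C_ratio : ((C N)%:R / N%:R)%R @[N --> \oo] --> c.
Hypothesis c_gt0 : (0 < c)%R.

Local Notation emp N := (empirical_distribution (@lam N)).

Lemma empirical_tail N (x : R) : (0 < N)%N ->
  (1 - emp N x)%R = (N%:R^-1 * \sum_(i < N) (x < lam i)%R%:R)%R.
Proof.
move=> N0; rewrite /empirical_distribution -[X in (X - _)%R](mulVf (x := N%:R)) ?pnatr_eq0 -?lt0n//.
rewrite -mulrBr; congr (_ * _)%R.
have -> : (N%:R = \sum_(i < N) 1 :> R)%R by rewrite sumr_const card_ord.
rewrite -sumrB.
by apply: eq_bigr => i _; rewrite ltNge; case: (_ <= _)%R; rewrite ?subrr ?subr0.
Qed.

(* By [t <= 1 + \sum_k (x k < t)], the tails at the [x k] sum to infinity when the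
   mean is infinite. *)
Lemma exists_large_partial_sums : exists x : nat -> R,
  [/\ forall k, (k%:R < x k < k.+1%:R)%R, forall k, {for x k, continuous F} &
    forall A : R, exists n, (A < \sum_(k < n) (1 - F (x k)))%R].
Proof.
have /choice[x xP] : forall k : nat, exists y : R,
    (k%:R < y < k.+1%:R)%R /\ {for y, continuous F}.
  move=> k; have [|y [ky yk cy]] := @exists_continuity_point _ L k%:R k.+1%:R.
    by rewrite ltr_nat.
  by exists y; rewrite ky yk.
exists x; split => [k|k|A]; [by have [] := xP k|by have [] := xP k|].
apply: contrapT => nA.
have bA n : (\sum_(k < n) (1 - F (x k)) <= A)%R.
  by rewrite leNgt; apply/negP => An; apply: nA; exists n.
have : \int[L]_(t in `[0%R, +oo[) t%:E <= (1 + A)%:E; last by rewrite L_mean leye_eq.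
have mxk k : measurable (`](x k), +oo[%classic : set (measurableTypeR R)) by exact: measurable_itv.
pose f k (t : measurableTypeR R) : \bar R := (\1_(`](x k), +oo[%classic : set (measurableTypeR R)) t)%:E.
have mf k : measurable_fun setT (f k) by apply/measurable_EFinP; exact: measurable_indic.
have f0 k t : 0 <= f k t by rewrite lee_fin.
apply: (@le_trans _ _ (\int[L]_t (1 + \sum_(k <oo) f k t))).
  rewrite [leLHS]integral_mkcond; apply: ge0_le_integral => //.
  - by move=> t _; rewrite patchE; case: ifPn => // /set_mem/=; rewrite in_itv/= andbT lee_fin.
  - by apply/(measurable_restrictT _ _).1.
  - by apply: emeasurable_funD => //; apply: ge0_emeasurable_sum.
  - move=> t _; have s0 : 0 <= \sum_(k <oo) f k t by exact: nneseries_ge0.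
    rewrite patchE; case: ifPn => [/set_mem/=|_]; last by rewrite adde_ge0.
    rewrite in_itv/= andbT => t0.
    (* For [k < n] one has [x k < k + 1 <= n <= t], so the first [n] indicators equal 1, and
       [t < n + 1]. *)
    pose n := Num.truncn t.
    apply: (@le_trans _ _ (1 + \sum_(0 <= k < n) f k t)); last first.
      by rewrite leeD2l//; exact: nneseries_lim_ge.
    rewrite (eq_big_nat _ _ (F2 := fun=> 1%:E)) => [|k /andP[_ kn]]; last first.
      rewrite /f indicE mem_set//= in_itv/= andbT.
      have [/andP[_ xk] _] := xP k; apply: lt_le_trans xk _.
      apply: le_trans (_ : n%:R <= t)%R; first by rewrite ler_nat.
      by have /andP[] := truncn_itv t0.
    rewrite sumEFin -EFinD lee_fin big_const_nat subn0 iter_addr addr0 addrC natr1.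
    by have /andP[_ /ltW] := truncn_itv t0.
rewrite ge0_integralD//; last 2 first.
- by move=> t _; exact: nneseries_ge0.
- exact: ge0_emeasurable_sum.
rewrite [X in X + _](_ : _ = 1); last first.
  by rewrite (integral_cst L measurableT 1) mul1e; exact: probability_setT.
rewrite EFinD leeD2l//.
rewrite integral_nneseries//.
apply: lime_le.
  by apply: is_cvg_nneseries => k _ _; exact: integral_ge0.
apply: nearW => n.
rewrite big_mkord [leLHS](_ : _ = \sum_(k < n) (1 - F (x k))%:E).
  by rewrite sumEFin lee_fin.
by apply: eq_bigr => k _; rewrite /f integral_indic// setIT; exact: tail_probability.
Qed.

(** Since [x k > k], at most [t + 1] of the [x k] lie below [t]. The empirical mean plus 1 thus
    dominates any finite sum of empirical tails at the [x k], and these converge because the [x k]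
    are continuity points of the limit. *)
Lemma mean_intensity_unbounded (A : R) :
  \forall N \near \oo, (A < N%:R^-1 * \sum_(i < N) lam i)%R.
Proof.
have [x [x_itv cx xA]] := exists_large_partial_sums.
have [n nA] := xA (A + 1)%R.
have cS : (\sum_(k < n) (1 - emp N (x k)))%R @[N --> \oo] --> (\sum_(k < n) (1 - F (x k)))%R.
  elim: n {nA} => [|n IH]; first by under eq_fun do rewrite big_ord0; rewrite big_ord0; exact: cvg_cst.
  under eq_fun do rewrite big_ord_recr; rewrite big_ord_recr/=.
  by apply: cvgD => //; apply: cvgB; [exact: cvg_cst|exact: L_limit].
near=> N; have N1 : (1 < N)%N by near: N; exists 2%N.
have AS : (A + 1 < \sum_(k < n) (1 - emp N (x k)))%R.
  by near: N; apply: (cvgr_gt _ cS).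
have N0 : (0 < N%:R^-1 :> R)%R by rewrite invr_gt0 ltr0n (ltn_trans _ N1).
suff : (\sum_(k < n) (1 - emp N (x k)) <= N%:R^-1 * \sum_(i < N) lam i + 1)%R by lra.
rewrite -[X in (_ + X)%R](mulVf (x := N%:R)); last by rewrite pnatr_eq0 -lt0n (ltn_trans _ N1).
rewrite -mulrDr [X in (_ <= _ * (_ + X))%R](_ : _ = \sum_(i < N) 1)%R; last first.
  by rewrite sumr_const card_ord.
rewrite -big_split/=.
under eq_bigr do rewrite empirical_tail ?(ltn_trans _ N1)//.
rewrite -mulr_sumr ler_pM2l// exchange_big/=; apply: ler_sum => i _.
have li := lam_gt0 N1 i.
have nS m : (\sum_(k < m) (x k < lam i)%R%:R <= lam i + 1 :> R)%R.
  elim: m => [|m IH]; first by rewrite big_ord0; lra.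
  have [xm|xm] := boolP (x m < lam i)%R; last first.
    by rewrite big_ord_recr/= (negbTE xm) addr0.
  apply: (@le_trans _ _ (\sum_(k < m.+1) 1)%R).
    by apply: ler_sum => k _; case: (_ < _)%R.
  rewrite sumr_const card_ord -[m.+1]addn1 natrD lerD2r.
  by have /andP[mx _] := x_itv m; exact/ltW/(lt_trans mx).
exact: nS.
Unshelve. all: by end_near. Qed.

(** Indices start at 0, so the items left out are those with [C N <= i]. If one of them had a rate
    above [K], so would the [C N] items before it, and the proportion of rates above [K] would be at
    least [C N / N], which eventually exceeds [c / 2]. *)
Lemma static_tail_bounded : exists2 K : R, (0 < K)%R &
  \forall N \near \oo, forall i : 'I_N, (C N <= i)%N -> (lam i <= K)%R.
Proof.
have c2 : (0 < c / 2)%R by rewrite divr_gt0.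
have [K0 K0c] := tail_probability_small L c2.
(* The bound is moved up to a positive continuity point, where the empirical distributions
   converge. *)
have [|K [K0K _ cK]] := @exists_continuity_point _ L (Num.max K0 0)%R (Num.max K0 0 + 1)%R.
  by rewrite ltrDl.
have Kc : (1 - F K < c / 2)%R.
  apply: le_lt_trans K0c; rewrite lerB//; apply: distribution_function_nondecreasing.
  by apply/ltW/(le_lt_trans _ K0K); rewrite le_max lexx.
exists K; first by apply: le_lt_trans K0K; rewrite le_max lexx orbT.
have cF : (1 - emp N K)%R @[N --> \oo] --> (1 - F K)%R.
  by apply: cvgB; [exact: cvg_cst|exact: L_limit].
near=> N; have N1 : (1 < N)%N by near: N; exists 2%N.
have N0 : (0 < N%:R :> R)%R by rewrite ltr0n (ltn_trans _ N1).
have FK : (1 - emp N K < c / 2)%R by near: N; apply: (cvgr_lt _ cF).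
have CN : (c / 2 < (C N)%:R / N%:R)%R.
  by near: N; apply: (cvgr_gt _ C_ratio); rewrite ltr_pdivrMr// ltr_pMr// ltrDl.
move=> i Ci; rewrite leNgt; apply/negP => Ki.
have := lt_trans FK CN; rewrite empirical_tail ?(ltn_trans _ N1)// mulrC ltr_pM2r ?invr_gt0//.
apply/negP; rewrite -leNgt.
rewrite -natr_sum ler_nat.
have CN' : (C N <= N)%N by apply: leq_trans Ci (ltnW (ltn_ord i)).
rewrite -[leqLHS]card_ord -sum1_card (big_ord_widen _ (fun=> 1%N) CN') big_mkcond/=.
apply: leq_sum => j _; case: ifP => // jC.
by rewrite (lt_le_trans Ki)// lam_sorted// ltnW// (leq_trans jC).
Unshelve. all: by end_near. Qed.

Lemma static_miss_cvg0 :
  ((\sum_(i < N | (C N <= i)%N) lam i) / \sum_(i < N) lam i)%R @[N --> \oo] --> (0 : R)%R.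
Proof.
have [K K0 tailK] := static_tail_bounded.
apply/cvgrPdist_le => e e0; near=> N.
have N1 : (1 < N)%N by near: N; exists 2%N.
have N0 : (0 < N%:R :> R)%R by rewrite ltr0n (ltn_trans _ N1).
(* The numerator is at most [K * N], so a mean rate above [K / e] keeps the ratio below [e]. *)
have mean : (K / e < N%:R^-1 * \sum_(i < N) lam i)%R.
  by near: N; exact: mean_intensity_unbounded.
have S0 : (0 < \sum_(i < N) lam i)%R.
  have KE : (0 < K / e)%R by rewrite divr_gt0.
  by have := lt_trans KE mean; rewrite pmulr_rgt0// invr_gt0.
rewrite sub0r normrN ger0_norm; last first.
  by apply: divr_ge0; [apply: sumr_ge0 => i _; exact/ltW/lam_gt0|exact: ltW].
rewrite ler_pdivrMr//; apply: (@le_trans _ _ (K * N%:R)%R).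
  apply: (@le_trans _ _ (\sum_(i < N | (C N <= i)%N) K)%R).
    apply: ler_sum => i Ci; move: i Ci; near: N; exact: tailK.
  apply: (@le_trans _ _ (\sum_(i < N) K)%R).
    by rewrite [leRHS](bigID (fun i : 'I_N => (C N <= i)%N))/= lerDl sumr_ge0// => i _; exact: ltW.
  by rewrite sumr_const card_ord mulr_natr.
move: mean; rewrite ltr_pdivrMr// -mulrA mulrC ltr_pdivlMr// => /ltW.
by rewrite [(_ * e)%R]mulrC.
Unshelve. all: by end_near. Qed.

End static_policy_asymptotics.

(** * Miss probabilities for a fixed number of items *)

Section fixed_number_of_items.
Context (R : realType) d (T : measurableType d).
Variables (P : probability T R) (theta : R -> T -> T).
Variables (F0 : probability (measurableTypeR R) R) (f0 : R -> R).
Variables (N : nat) (lam : 'I_N -> R) (Phi : 'I_N -> R.-ker T ~> measurableTypeR R).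
Hypothesis F0_nonneg : F0 `]-oo, 0%R[%classic = 0.
Hypothesis F0_density : density F0 f0.
Hypothesis F0_mean : \int[F0]_x x%:E = 1.
Hypothesis flow : measure_preserving_flow P theta.
Hypothesis lam_gt0 : forall i, (0 < lam i)%R.
Hypothesis renewal : forall i, stationary_renewal_process P theta (Phi i).
Hypothesis intensityE : forall i, intensity P (Phi i) = (lam i)%:E.
Hypothesis interE : forall i, interarrival_distribution P theta (Phi i)
  (fun t => distribution_function F0 (lam i * t)).
Hypothesis indep : independent_processes P Phi.

Local Notation X := (observed_hazard F0 f0 lam Phi).

Let pp i : point_process (Phi i). Proof. by have [] := renewal i. Qed.

Let compat i : flow_compatible theta (Phi i). Proof. by have [] := renewal i. Qed.

Let mX i : measurable_fun setT (X i).
Proof. exact: measurable_observed_hazard. Qed.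

Lemma integer_valued_superposition w : integer_valued (ksuperposition Phi w).
Proof.
move=> B mB bB; have /choice[n nE] i := @pp i w B mB bB.
exists (\sum_(i < N) n i)%N; rewrite /ksuperposition/= /superposition natr_sum -sumEFin.
by apply: eq_bigr => i _; exact: nE.
Qed.

Lemma intensity_superposition :
  intensity P (ksuperposition Phi) = (\sum_(i < N) lam i)%:E.
Proof.
rewrite /intensity /ksuperposition/= /superposition ge0_integral_sum//; last first.
  by move=> i; apply: measurable_kernel; exact: measurable_itv.
by rewrite -sumEFin; apply: eq_bigr => i _; exact: intensityE.
Qed.

Let sum_lam_gt0 (i : 'I_N) : (0 < \sum_(j < N) lam j)%R.
Proof. by rewrite (bigD1 i)//= ltr_pwDl// sumr_ge0// => j _; exact: ltW. Qed.

(** The superposition dominates each of its components as a measure on the line, hence so do the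
    unnormalised Palm measures. This carries the absence of ties over to the Palm measure of each
    item. *)
Lemma superposition_negligible_palm (k : 'I_N) (E : set T)
    (M : {measure set T -> \bar R}) :
  (forall f, (forall w, 0 <= f w) -> measurable_fun setT f ->
    \int[M]_w f w = \int[P]_w \int[Phi k w]_(s in `]0%R, 1%R]) f (theta s w)) ->
  measurable E -> palm P theta (ksuperposition Phi) E = 0 -> M E = 0.
Proof.
move=> ME mE /eqP; rewrite /palm intensity_superposition/= mule_eq0 eqe.
rewrite invr_eq0 gt_eqF ?sum_lam_gt0//= => /eqP E0.
pose D : set (measurableTypeR R) := `]0%R, 1%R]%classic.
have mD : measurable D by exact: measurable_itv.
pose f (z : T * measurableTypeR R) : \bar R := (\1_D z.2)%:E * (\1_E (theta z.2 z.1))%:E.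
have f0' z : 0 <= f z by rewrite mule_ge0.
have mf : measurable_fun setT f.
  apply: emeasurable_funM; apply/measurable_EFinP.
    by apply: measurableT_comp => //; exact: measurable_indic.
  apply: (measurableT_comp (measurable_indic mE)).
  apply: (measurableT_comp (flow_measurable flow)
    (g := fun z : T * measurableTypeR R => (z.2, z.1))).
  exact: measurable_fun_pair.
have fE (mu : {measure set (measurableTypeR R) -> \bar R}) w :
    \int[mu]_(s in `]0%R, 1%R]) (\1_E (theta s w))%:E = \int[mu]_s f (w, s).
  rewrite [LHS]integral_mkcond; apply: eq_integral => s _.
  by rewrite patchE /f/= [\1_D s]indicE -/D; case: ifPn => sD; rewrite ?mul1e ?mul0e.
apply/eqP; rewrite eq_le measure_ge0 andbT -E0 (palm_measureE ME mE).
under eq_integral do rewrite fE; under [leRHS]eq_integral do rewrite fE.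
apply: ge0_le_integral => //.
- by move=> w _; exact: integral_ge0.
- apply: (measurable_fun_integral_integer_valued _ _ f0' mf) => [U mU|w]; last exact: pp.
  exact: measurable_kernel.
- apply: (measurable_fun_integral_integer_valued
    (K := ksuperposition Phi) _ _ f0' mf) => [U mU|w]; last exact: integer_valued_superposition.
  exact: measurable_kernel.
- move=> w _; apply: ge0_le_measure_integral => //; last first.
    exact: (measurableT_comp mf (pair1_measurable _)).
  move=> S mS; rewrite [leRHS]/(superposition Phi w S) /superposition (bigD1 k)//=.
  by rewrite leeDl// sume_ge0.
Qed.

Hypothesis no_ties : forall i j : 'I_N, i != j ->
  palm P theta (ksuperposition Phi) [set w | X i w = X j w] = 0.

Let measurable_tie i j : measurable [set w | X i w = X j w].
Proof.
have := measurable_fun_eqr (mX i) (mX j) measurableT (Y := [set true]) Logic.I.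
by rewrite setTI; congr measurable; apply/seteqP; split => w /= /eqP.
Qed.

Let palm_meas i := cid (palm_measure_exists flow (pp i)).

Let M i := sval (palm_meas i).

Let ME i f : (forall w, 0 <= f w) -> measurable_fun setT f ->
  \int[M i]_w f w = \int[P]_w \int[Phi i w]_(s in `]0%R, 1%R]) f (theta s w).
Proof. exact: (svalP (palm_meas i)). Qed.

(** This is the exchange for the sure event, [lam i] being the total mass of [M i]. *)
Lemma expected_observed_hazard i : \int[P]_w (X i w)%:E = (lam i)%:E.
Proof.
have := palm_exchange F0_nonneg F0_density F0_mean flow lam_gt0 renewal
  intensityE interE indep predT (@ME i).
rewrite /= (_ : [set w | _] = setT); last by apply/seteqP; split.
rewrite (palm_measureT (intensityE i) (@ME i)) => ->.
by apply: eq_integral => w _; rewrite indicT mule1.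
Qed.

Lemma miss_probability_static (C : nat) :
  miss_probability P theta lam Phi (static_policy N C) =
  ((\sum_(i < N | (C <= i)%N) lam i) / \sum_(i < N) lam i)%:E.
Proof.
rewrite /miss_probability mulr_suml -sumEFin [RHS]big_mkcond/=; apply: eq_bigr => i _.
rewrite leqNgt; case: (boolP (i < C)%N) => iC /=.
  rewrite (palmE (pp i) (compat i) (intensityE i) (@ME i) measurable0) => [|w _].
    by rewrite measure0 !mule0.
  by rewrite /static_policy/= finset.inE iC.
rewrite (palmE (pp i) (compat i) (intensityE i) (@ME i) measurableT) => [|w _].
  by rewrite (palm_measureT (intensityE i) (@ME i)) -!EFinM mulVf ?mulr1// gt_eqF.
by rewrite /static_policy/= finset.inE (negbTE iC).
Qed.

(** The tie-breaking rule is arbitrary, whereas the exchange concerns events defined by strict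
    comparisons with [X i]. The events [Q i] of having at least [C] strict dominators mediate
    between the two. *)
Lemma miss_probability_optimal_le (C : nat) (S : T -> R -> {set 'I_N}) :
  (C <= N)%N -> optimal_causal_policy F0 f0 lam Phi C S ->
  miss_probability P theta lam Phi S <= miss_probability P theta lam Phi (static_policy N C).
Proof.
move=> CN [[_ mS] [rule [rule_top ruleE]]]; rewrite miss_probability_static.
pose x w i := X i w.
have SE w : S w 0%R = rule (x w) by rewrite ruleE.
have cardS w : #|S w 0%R| = C by rewrite SE; have [] := rule_top (x w).
have top w i j : i \in S w 0%R -> j \notin S w 0%R -> (X j w <= X i w)%R.
  by rewrite SE; have [_] := rule_top (x w); exact.
pose dom i w := [set j | (j != i) && (X i w < X j w)%R]%SET.
pose Q i := [set w | (C <= #|dom i w|)%N].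
have mQ i : measurable (Q i).
  exact: (measurable_strict_dominators (fun A => (C <= #|A|)%N)).
have mA i : measurable [set w | i \notin S w 0%R].
  rewrite (_ : [set w | _] = ~` [set w | i \in S w 0%R]); first exact: measurableC.
  by apply/seteqP; split => w /= /negP.
have MA i : M i [set w | i \notin S w 0%R] <= \int[P]_w ((X i w)%:E * (\1_(Q i) w)%:E).
  rewrite -(palm_exchange F0_nonneg F0_density F0_mean flow lam_gt0 renewal
    intensityE interE indep (fun A => (C <= #|A|)%N) (@ME i)).
  pose ties := \big[setU/set0]_(j < N | j != i) [set w | X i w = X j w].
  have [mties ties0] : measurable ties /\ M i ties = 0.
    apply: (big_ind (fun B => measurable B /\ M i B = 0)) => [|A B [mA' A0] [mB B0]|j ji].
    - by split => //; exact: measure0.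
    - by split; [exact: measurableU|rewrite measureU0].
    - split; first exact: measurable_tie.
      apply: (superposition_negligible_palm (@ME i)); first exact: measurable_tie.
      by apply: no_ties; rewrite eq_sym.
  rewrite -[leRHS](measureU0 (mQ i) mties ties0).
  apply: le_measure; rewrite ?inE; [exact: mA|exact: measurableU|move=> w /= iS].
  have [[j ji xij]|nt] := pselect (exists2 j, j != i & X i w = X j w).
    by right; rewrite /ties (bigD1 j)//=; left.
  left; rewrite /Q/= -(cardS w).
  apply: (card_strict_dominators (A := S w 0%R) (x := X^~ w)) => // [j k|j ji].
    exact: top.
  by apply/eqP => xij; apply: nt; exists j.
(* The weight [lam i] cancels the normalisation of the Palm probability. *)
have missE i : (lam i / \sum_(j < N) lam j)%:E * palm P theta (Phi i) [set w | i \notin S w 0%R] =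
    (\sum_(j < N) lam j)^-1%:E * M i [set w | i \notin S w 0%R].
  rewrite (palmE (pp i) (compat i) (intensityE i) (@ME i) (mA i))// muleA -EFinM.
  by rewrite mulrAC divff ?mul1r// gt_eqF.
have mXQ i : measurable_fun setT (fun w => (X i w)%:E * (\1_(Q i) w)%:E).
  by apply: emeasurable_funM; apply/measurable_EFinP.
have X0 i w : (0 <= X i w)%R by exact: observed_hazard_ge0.
rewrite /miss_probability (eq_bigr _ (fun i _ => missE i)) -ge0_sume_distrr//.
rewrite mulrC EFinM lee_wpmul2l//.
  by rewrite lee_fin invr_ge0 sumr_ge0// => i _; exact: ltW.
apply: (@le_trans _ _ (\sum_(i < N) \int[P]_w ((X i w)%:E * (\1_(Q i) w)%:E))).
  by apply: lee_sum => i _; exact: MA.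
rewrite -ge0_integral_sum//; last by move=> i w _; rewrite mule_ge0// lee_fin.
rewrite -sumEFin; under [leRHS]eq_bigr do rewrite -expected_observed_hazard.
rewrite -[leRHS]big_filter -ge0_integral_sum//; last 2 first.
- by move=> i; exact/measurable_EFinP.
- by move=> i w _; rewrite lee_fin.
apply: ge0_le_integral => //.
- by move=> w _; apply: sume_ge0 => i _; rewrite mule_ge0// lee_fin.
- exact: emeasurable_sum.
- by apply: emeasurable_sum => i; exact/measurable_EFinP.
move=> w _; rewrite big_filter.
rewrite (eq_bigr (fun i => (if (C <= #|dom i w|)%N then X i w else 0%R)%:E)); last first.
  move=> i _; rewrite indicE; case: ifPn => [Ci|/negP Ci].
    by rewrite mem_set// mule1.
  by rewrite memNset// mule0.
rewrite !sumEFin lee_fin -big_mkcond/=.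
(* Back under [P], the inclusion of [Q i] in the miss event holds at every outcome, ties included,
   and the two policies can be compared pointwise. *)
apply: (@le_trans _ _ (\sum_(i | i \notin S w 0%R) X i w)%R).
  rewrite [leLHS]big_mkcond [leRHS]big_mkcond/=; apply: ler_sum => i _.
  case: ifPn => [Ci|_]; last by case: ifPn.
  rewrite (strict_dominators_notin_top (x := X^~ w) (A := S w 0%R))// ?cardS// => j k.
  exact: top.
have cB : #|S w 0%R| = #|[set i : 'I_N | (i < C)%N]%SET|.
  by rewrite cardS -sum1dep_card -(big_ord_widen N (fun=> 1%N) CN) sum1_card card_ord.
apply: le_trans (sum_notin_top_le (top w) cB) _.
rewrite [leLHS](eq_bigl (fun i : 'I_N => (C <= i)%N))// => i.
by rewrite finset.inE -leqNgt.
Qed.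

End fixed_number_of_items.

Local Close Scope ereal_scope.
Unset Implicit Arguments.

Theorem theorem4 (R : realType)
    (F0 : probability (measurableTypeR R) R) (f0 : R -> R)
    (d : nat -> measure_display) (T : forall N, measurableType (d N))
    (P : forall N, probability (T N) R) (theta : forall N, R -> T N -> T N)
    (C : nat -> nat) (lambda : forall N, 'I_N -> R)
    (Phi : forall N, 'I_N -> R.-ker (T N) ~> measurableTypeR R)
    (L : probability (measurableTypeR R) R) (c : R)
    (Cstar : forall N, T N -> R -> {set 'I_N})
    (F0_nonneg : F0 `]-oo, 0%R[%classic = 0%E)
    (F0_density : density F0 f0)
    (F0_mean : (\int[F0]_x x%:E = 1)%E)
    (flow : forall N, (1 < N)%N -> measure_preserving_flow (P N) (theta N))
    (C_bounds : forall N, (1 < N)%N -> (1 <= C N < N)%N)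
    (lambda_pos : forall N, (1 < N)%N -> forall i : 'I_N, 0 < lambda N i)
    (lambda_sorted : forall N, (1 < N)%N ->
       forall i j : 'I_N, (i <= j)%N -> lambda N j <= lambda N i)
    (Phi_renewal : forall N, (1 < N)%N -> forall i : 'I_N,
       stationary_renewal_process (P N) (theta N) (Phi N i))
    (Phi_intensity : forall N, (1 < N)%N -> forall i : 'I_N,
       intensity (P N) (Phi N i) = (lambda N i)%:E)
    (Phi_interarrival : forall N, (1 < N)%N -> forall i : 'I_N,
       interarrival_distribution (P N) (theta N) (Phi N i)
         (fun t => distribution_function F0 (lambda N i * t)))
    (Phi_independent : forall N, (1 < N)%N ->
       independent_processes (P N) (Phi N))
    (L_limit :
       weakly_converges (fun N => empirical_distribution (lambda N)) L)
    (L_no_atom0 : L [set 0%R] = 0%E)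
    (no_ties : forall N (i j : 'I_N), i != j ->
       palm (P N) (theta N) (ksuperposition (Phi N))
         [set w | observed_hazard F0 f0 (lambda N) (Phi N) i w =
                  observed_hazard F0 f0 (lambda N) (Phi N) j w] = 0%E)
    (L_mean_infinite : (\int[L]_(x in `[0%R, +oo[) x%:E = +oo)%E)
    (C_ratio : (C N)%:R / N%:R @[N --> \oo] --> c)
    (c_range : 0 < c <= 1)
    (Cstar_optimal : forall N, (1 < N)%N ->
       optimal_causal_policy F0 f0 (lambda N) (Phi N) (C N) (Cstar N)) :
  (forall N, (1 < N)%N ->
     (miss_probability (P N) (theta N) (lambda N) (Phi N) (Cstar N) <=
      miss_probability (P N) (theta N) (lambda N) (Phi N)
        (@static_policy R (d N) (T N) N (C N)))%E) /\
  miss_probability (P N) (theta N) (lambda N) (Phi N)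
    (@static_policy R (d N) (T N) N (C N)) @[N --> \oo] --> 0%E.
Proof.
have missE N (N1 : (1 < N)%N) := miss_probability_static (flow N N1)
  (lambda_pos N N1) (Phi_renewal N N1) (Phi_intensity N N1) (C N).
split=> [N N1|].
  apply: (miss_probability_optimal_le F0_nonneg F0_density F0_mean (flow N N1)
    (lambda_pos N N1) (Phi_renewal N N1) (Phi_intensity N N1) (Phi_interarrival N N1)
    (Phi_independent N N1) (no_ties N) _ (Cstar_optimal N N1)).
  by have /andP[_ /ltnW] := C_bounds N N1.
have /andP[c0 _] := c_range.
have cvg0 := static_miss_cvg0 L_limit L_mean_infinite lambda_pos lambda_sorted C_ratio c0.
have N1 : \forall N \near \oo, (1 < N)%N by exists 2%N.
apply/fine_cvgP; split; first by near=> N; rewrite missE//; near: N.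
apply: cvg_trans cvg0; apply: near_eq_cvg.
by near=> N; rewrite /= missE//; near: N.
Unshelve. all: by end_near. Qed.
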